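(* For each $n$ let $\mathcal{C},\mathcal{C}'$ be conjugacy classes of $S_n$ whose elements have $c_j$ (resp. $c'_j$) $j$-cycles. Let $\pi\in\mathcal{C}$, $\pi'\in\mathcal{C}'$ be independent and uniform, and let $N$ be the number of orbits of $\langle\pi,\pi'\rangle$ on $\{1,\dots,n\}$ of size at most $n/2$. Assume $c_1+c'_1=o(n^{2/3})$, $(c_1+c_2^{1/2})(c'_1+{c'_2}^{1/2})=O(n)$, and that there is a constant $\epsilon>0$ with $c_2+c'_2\leq(1-\epsilon)n$. Then \[ \mathbf{P}(N=0)=e^{-\mathbf{E}N}+o(1). \]
   Context: Asymptotic notation is with respect to $n\to\infty$. *)

(* Defs.v *)
From HB Require Import structures.
From mathcomp Require Import all_boot all_order all_algebra all_fingroup.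
From mathcomp Require Import all_classical all_reals all_analysis.
Set Implicit Arguments. Unset Strict Implicit. Unset Printing Implicit Defensive.
Import Order.TTheory GRing.Theory Num.Theory.

Definition ncycles (n : nat) (s : {perm 'I_n}) (j : nat) : nat :=
  #|[set X in porbits s | #|X| == j]|.

Definition conjclass (n : nat) (g : {perm 'I_n}) : {set {perm 'I_n}} :=
  (g ^: [set: {perm 'I_n}])%g.

Definition Nsmall (n : nat) (p q : {perm 'I_n}) : nat :=
  #|[set O in [set orbit 'P <<[set p; q]>>%g x | x : 'I_n] | (#|O| * 2 <= n)%N]|.

Local Open Scope ring_scope.

Definition probN0 (R : realType) (n : nat) (g h : {perm 'I_n}) : R :=
  (#|[set pq : {perm 'I_n} * {perm 'I_n} |
       [&& pq.1 \in conjclass g, pq.2 \in conjclass h & Nsmall pq.1 pq.2 == 0%N]]|)%:R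
  / (#|conjclass g| * #|conjclass h|)%:R.

Definition expN (R : realType) (n : nat) (g h : {perm 'I_n}) : R :=
  (\sum_(p in conjclass g) \sum_(q in conjclass h) Nsmall p q)%:R
  / (#|conjclass g| * #|conjclass h|)%:R.

(* Main.v *)
(* Conjugating both permutations, one may fix pi = g n and take pi' = (h n)^v with v a uniform permutation, so that every probability is an average over v.

Orbits of bounded size.  For permutations rho, rho' of a finite set Y, the expected number of injections of Y into 'I_n that are equivariant for both (rho, pi) and (rho', pi') is I J (n - #|Y|)! / n!, where I and J count the injections equivariant for (rho, g) and (rho', h).  Hence the r-th factorial moment of the number N_M of orbits of size at most M is a finite sum of such terms over disjoint unions of r transitive pairs.  I is at most the product over the cycles of rho of the number of points of g in cycles of that length, and a transitive pair on k points has at most k + 1 cycles in total; with the hypotheses on c_1, c_2, c'_1, c'_2 this makes each transitive term bounded, and makes the injections of two pieces that collide negligible.  So the r-th factorial moment is (E N_M)^r + o(1), and Bonferroni's inequalities give P(N_M = 0) = exp(- E N_M) + o(1).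

Orbits of size k with M < k <= n / 2.  Their expected number is at most a_k a'_k / 'C(n, k), where a_k, a'_k count the k-sets invariant under g and h.  As a_k x^k <= prod_j (1 + x^j)^(c_j), choosing x y close to k / n bounds this by C k exp(- eps k / 4) when k is at most a small multiple of n, and by an exponentially small quantity for larger k; the sum over k > M tends to 0 as M grows, uniformly in n. *)
Require Import Defs.
From HB Require Import structures.
From mathcomp Require Import all_boot all_order all_algebra all_fingroup all_solvable.
From mathcomp Require Import zify.
Set Implicit Arguments. Unset Strict Implicit. Unset Printing Implicit Defensive.

(** * Orbits of two permutations as minimal stable sets *)

Definition stable2 (T : finType) (p q : {perm T}) (A : {set T}) : bool :=
  [forall x in A, (p x \in A) && (q x \in A)].

(* Minimal nonempty sets stable under p and q, i.e. the orbits of <<[set p; q]>> (mem_orbits), in a form that embeddings transport easily. *)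
Definition atom (T : finType) (p q : {perm T}) (A : {set T}) : bool :=
  [&& A != set0, stable2 p q A &
   [forall B : {set T}, [&& B != set0, B \subset A & stable2 p q B] ==> (B == A)]].

Section Atoms.
Variables (T : finType) (p q : {perm T}).
Implicit Types A B : {set T}.

Lemma stable2P A :
  reflect {in A, forall x, p x \in A /\ q x \in A} (stable2 p q A).
Proof.
apply: (iffP forall_inP) => sA x /sA; first by move/andP.
by case=> -> ->.
Qed.

Lemma stable2I A B : stable2 p q A -> stable2 p q B -> stable2 p q (A :&: B).
Proof.
move=> /stable2P sA /stable2P sB; apply/stable2P => x /setIP[xA xB].
by rewrite !inE; case: (sA _ xA) => -> ->; case: (sB _ xB) => -> ->.
Qed.

Lemma atom_neq0 A : atom p q A -> A != set0.
Proof. by case/and3P. Qed.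

Lemma atom_stable A : atom p q A -> stable2 p q A.
Proof. by case/and3P. Qed.

Lemma atom_min A B : atom p q A -> B != set0 -> B \subset A -> stable2 p q B ->
  B = A.
Proof.
by case/and3P=> _ _ /forallP/(_ B) + B0 sBA sB; rewrite B0 sBA sB => /eqP.
Qed.

Lemma atom_disjoint A B : atom p q A -> atom p q B -> A != B -> [disjoint A & B].
Proof.
move=> aA aB; apply: contraR; rewrite -setI_eq0 => AB0.
have sAB : stable2 p q (A :&: B) by apply: stable2I; exact: atom_stable.
rewrite -(atom_min aA AB0 (subsetIl _ _) sAB).
by apply/eqP/(atom_min aB AB0 (subsetIr _ _) sAB).
Qed.

Lemma mem_orbits A :
  (A \in [set orbit 'P <<[set p; q]>>%g x | x : T]) = atom p q A.
Proof.
set G := <<[set p; q]>>%G.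
have actsS B : stable2 p q B -> [acts G, on B | 'P].
  move=> /stable2P sB; rewrite gen_subG; apply/subsetP => s.
  rewrite !inE => /orP[] /eqP->; apply/subsetP => x xB;
    by rewrite inE /=; case: (sB _ xB).
have stab x : stable2 p q (orbit 'P G x).
  apply/stable2P => y yx; split.
    by have:= orbit_actr 'P x y (a := p) (G := G); rewrite /= => -> //; apply/mem_gen; rewrite !inE eqxx.
  by have:= orbit_actr 'P x y (a := q) (G := G); rewrite /= => -> //; apply/mem_gen; rewrite !inE eqxx orbT.
apply/imsetP/idP => [[x _ ->]|aA].
  apply/and3P; split => //.
    by apply/set0Pn; exists x; apply: orbit_refl.
  apply/forallP => B; apply/implyP => /and3P[/set0Pn[y yB] sBO sB].
  rewrite eqEsubset sBO /=.
  have yx := subsetP sBO _ yB.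
  by rewrite -(orbit_eqP yx) acts_sub_orbit // actsS.
have /set0Pn[x xA] := atom_neq0 aA.
exists x => //; apply/esym/(atom_min aA).
- by apply/set0Pn; exists x; apply: orbit_refl.
- by rewrite acts_sub_orbit //; apply/actsS/atom_stable.
exact: stab.
Qed.
End Atoms.

(** * Equivariant injections *)

Section Embeddings.
Variables (Y Z : finType).
Implicit Types (f : {ffun Y -> Z}) (s t : {perm Y}) (p q g h v : {perm Z}).

(** The symmetric group is transitive on tuples of distinct points, and [a] and [b] are such tuples
    once [Y] is enumerated. *)
Lemma perm_extend (a b : Y -> Z) : injective a -> injective b ->
  exists v : {perm Z}, forall y, v (a y) = b y.
Proof.
move=> ia ib.
have le_YZ : #|Y| <= #|Z| by rewrite -(card_codom ia) max_card.
have tr := ntransitive_weak le_YZ (Sym_trans Z).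
have dt (c : Y -> Z) : injective c -> [tuple c (enum_val i) | i < #|Y|] \in #|Y|.-dtuple(setT).
  move=> ic; apply/dtuple_onP; split => [i j|i]; last by rewrite inE.
  by rewrite !tnth_mktuple => /ic/enum_val_inj.
have /imsetP[v _ e] : [tuple b (enum_val i) | i < #|Y|] \in
    orbit ('P * #|Y|) 'Sym_Z [tuple a (enum_val i) | i < #|Y|].
  by rewrite (atransP tr) dt.
exists v => y; have /(congr1 (fun w => tnth w (enum_rank y))) := e; rewrite /= tnth_mktuple enum_rankK => ->.
by rewrite tnth_map tnth_mktuple enum_rankK.
Qed.

(** The solutions form a coset of the group of permutations supported off the image of [a]. *)
Lemma card_perm_extend (a b : Y -> Z) : injective a -> injective b ->
  #|[set v : {perm Z} | [forall y, v (a y) == b y]]| = (#|Z| - #|Y|)`!.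
Proof.
move=> ia ib; have [v0 v0E] := perm_extend ia ib.
have -> : [set v : {perm Z} | [forall y, v (a y) == b y]] =
    [set (w * v0)%g | w in perm_on (~: [set a y | y : Y])].
  apply/setP => v; rewrite inE; apply/forallP/imsetP => [vE|[w won ->] y].
    exists (v * v0^-1)%g; last by rewrite mulgKV.
    rewrite unfold_in; apply/subsetP => x; rewrite !inE; apply: contra.
    case/imsetP => y _ ->; by rewrite permM (eqP (vE y)) -v0E permK.
  rewrite permM (out_perm won) ?v0E // inE negbK; exact: imset_f.
rewrite card_imset; last exact: mulIg.
by rewrite card_perm cardsCs setCK card_imset.
Qed.

Definition Einj s g : {set {ffun Y -> Z}} :=
  [set f : {ffun Y -> Z} | injectiveb f & [forall y, f (s y) == g (f y)]].

Lemma EinjP s g f :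
  reflect (injective f /\ forall y, f (s y) = g (f y)) (f \in Einj s g).
Proof.
rewrite inE; apply: (iffP andP) => -[].
  by move=> /injectiveP fi /forallP fe; split => // y; apply/eqP.
by move=> fi fe; split; [apply/injectiveP | apply/forallP => y; apply/eqP].
Qed.

(** Double counting: [f] is equivariant for [h ^ v] exactly when it is [v] after some [e] in
    [Einj t h], and then [e] is unique. For fixed [e] and [f], the permutations [v] carrying [e] to
    [f] are counted by [card_perm_extend]. *)
Lemma sum_card_Einj s t g h :
  \sum_(v : {perm Z}) #|Einj s g :&: Einj t (h ^ v)%g| =
  #|Einj s g| * #|Einj t h| * (#|Z| - #|Y|)`!.
Proof.
have step v : #|Einj s g :&: Einj t (h ^ v)%g| =
    \sum_(f in Einj s g) \sum_(e in Einj t h) [forall y, v (e y) == f y].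
  rewrite -sum1_card big_mkcond [RHS]big_mkcond; apply: eq_bigr => f _.
  rewrite in_setI; case: (f \in Einj s g) => //=; case: ifP.
    move/EinjP => [fi fe].
    pose e0 : {ffun Y -> Z} := [ffun y => (v^-1)%g (f y)].
    have e0in : e0 \in Einj t h.
      apply/EinjP; split => [x y|y]; rewrite !ffunE; first by move/perm_inj/fi.
      by rewrite fe conjgE !permM permK.
    rewrite (bigD1 e0) //= big1 => [|e /andP[_ ne]].
      by rewrite addn0; apply/esym/eqP; rewrite eqb1; apply/forallP => y; rewrite ffunE permKV.
    apply/eqP; rewrite eqb0; apply: contra ne => /forallP ve.
    by apply/eqP/ffunP => y; rewrite ffunE -(eqP (ve y)) permK.
  move=> /negP nf; apply/esym/big1 => e /EinjP[ei ee].
  apply/eqP; rewrite eqb0; apply/forallP => ve; apply: nf.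
  apply/EinjP; split => [x y|y]; rewrite -!(eqP (ve _)); first by move/perm_inj/ei.
  by rewrite ee conjgE !permM permK.
rewrite (eq_bigr _ (fun v _ => step v)) exchange_big /=.
rewrite -[#|_| * _ * _]mulnA -sum_nat_const; apply: eq_bigr => f /EinjP[fi _].
rewrite exchange_big /= -sum_nat_const; apply: eq_bigr => e /EinjP[ei _].
rewrite -(card_perm_extend ei fi) -sum1_card [RHS]big_mkcond; apply: eq_bigr => v _.
by rewrite inE; case: ifP.
Qed.

Lemma stable2_imset s t p q f (B : {set Y}) :
  f \in Einj s p -> f \in Einj t q -> stable2 p q (f @: B) = stable2 s t B.
Proof.
case/EinjP=> fi fs /EinjP[_ ft]; apply/stable2P/stable2P => [sB y yB|sB _ /imsetP[y yB ->]].
  have [] := sB _ (imset_f f yB); rewrite -fs -ft.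
  by move=> /imsetP[a aB /fi->] /imsetP[b bB /fi->].
by rewrite -fs -ft; case: (sB _ yB) => *; split; apply: imset_f.
Qed.

Lemma atom_imset s t p q f (A : {set Y}) :
  f \in Einj s p -> f \in Einj t q -> atom p q (f @: A) = atom s t A.
Proof.
move=> fs ft; have /EinjP[fi _] := fs.
rewrite /atom (stable2_imset A fs ft) imset_eq0; congr [&& _, _ & _].
apply/forallP/forallP => H B; apply/implyP => /and3P[B0 BA sB].
  have := H (f @: B); rewrite imset_eq0 B0 imsetS // (stable2_imset B fs ft) sB /=.
  by rewrite (inj_eq (imset_inj fi)).
(* A competitor [B] inside the image is itself an image, so minimality in [Y] can be applied to its
   preimage. *)
have eB : B = f @: (f @^-1: B).
  apply/setP => x; apply/idP/imsetP => [xB|[y + ->]]; last by rewrite inE.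
  by have /imsetP[y yA xy] := subsetP BA _ xB; exists y; rewrite ?inE -?xy.
rewrite {}eB in B0 BA sB *; move: (f @^-1: B) => C in B0 BA sB *.
have := H C; rewrite -(imset_eq0 f) B0 -(stable2_imset C fs ft) sB andbT /=.
have -> : C \subset A.
  by apply/subsetP => y yC; have /imsetP[z zA /fi->] := subsetP BA _ (imset_f f yC).
by move=> /eqP->.
Qed.

Lemma perm_pullback p f : injective f -> (forall y, p (f y) \in f @: [set: Y]) ->
  exists s, forall y, f (s y) = p (f y).
Proof.
move=> fi st; have ex y : exists z, f z == p (f y).
  by have /imsetP[z _ e] := st y; exists z; rewrite e.
pose a y := xchoose (ex y).
have aE y : f (a y) = p (f y) by apply/eqP/(xchooseP (ex y)).
have ai : injective a by move=> x y e; apply/fi/(@perm_inj _ p); rewrite -!aE e.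
by exists (perm ai) => y; rewrite permE aE.
Qed.

(* Each embedding of a transitive pair has an atom as image; conversely an enumeration of an atom of size #|Y| pulls (p, q) back to exactly one transitive pair on Y. *)
Lemma sum_card_transitive p q (F : {set Z}) :
  \sum_(c : {perm Y} * {perm Y} | atom c.1 c.2 [set: Y])
     #|[set f in Einj c.1 p :&: Einj c.2 q | [disjoint f @: [set: Y] & F]]| =
  #|Y|`! * #|[set A | [&& atom p q A, #|A| == #|Y| & [disjoint A & F]]]|.
Proof.
have -> : \sum_(c : {perm Y} * {perm Y} | atom c.1 c.2 [set: Y])
     #|[set f in Einj c.1 p :&: Einj c.2 q | [disjoint f @: [set: Y] & F]]| =
   \sum_(f : {ffun Y -> Z} | [&& injectiveb f, atom p q (f @: [set: Y]) & [disjoint f @: [set: Y] & F]]) 1.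
  rewrite (eq_bigr (fun c : {perm Y} * {perm Y} => \sum_(f : {ffun Y -> Z})
     ((f \in Einj c.1 p) && (f \in Einj c.2 q) && [disjoint f @: [set: Y] & F] : nat))); last first.
    move=> c _; rewrite -sum1_card [LHS]big_mkcond; apply: eq_bigr => f _.
    by rewrite in_set in_setI; case: ifP.
  rewrite exchange_big [RHS]big_mkcond; apply: eq_bigr => f _.
  case: ifP => [/and3P[/injectiveP fi af dF]|nf].
    have /stable2P st := atom_stable af.
    have [s sE] : exists s, forall y, f (s y) = p (f y).
      by apply: perm_pullback => // y; case: (st _ (imset_f f (in_setT y))).
    have [t tE] : exists t, forall y, f (t y) = q (f y).
      by apply: perm_pullback => // y; case: (st _ (imset_f f (in_setT y))).
    have fs : f \in Einj s p by apply/EinjP.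
    have ft : f \in Einj t q by apply/EinjP.
    rewrite (bigD1 (s, t)) /=; last by rewrite -(atom_imset _ fs ft).
    rewrite fs ft dF /= big1 // => -[a b] /andP[_ nab]; apply/eqP; rewrite eqb0 /=.
    apply: contra nab => /andP[/andP[/EinjP[_ fa] /EinjP[_ fb]] _].
    apply/eqP; congr (_, _); apply/permP => y; apply: fi; by rewrite ?fa ?fb ?sE ?tE.
  apply: big1 => -[s t] /= a; apply/eqP; rewrite eqb0; apply/negP => /andP[/andP[fs ft] dF].
  move/negP: nf; apply; rewrite (atom_imset _ fs ft) a dF !andbT.
  by have /EinjP[/injectiveP] := fs.
rewrite (partition_big (fun f : {ffun Y -> Z} => f @: [set: Y])
  (mem [set A | [&& atom p q A, #|A| == #|Y| & [disjoint A & F]]])) /=; last first.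
  by move=> f /and3P[/injectiveP fi af dF]; rewrite inE af dF card_imset // cardsT eqxx.
rewrite mulnC -sum_nat_const; apply: eq_bigr => A; rewrite inE => /and3P[aA /eqP cA dA].
rewrite sum1_card -[RHS]ffactnn -{1}cA -card_inj_ffuns_on -cardsE; apply: eq_card => f.
rewrite !inE unfold_in /=; apply/idP/idP => [/andP[/and3P[fi _ _] /eqP<-]|/andP[/ffun_onP fA fi]].
  by rewrite fi andbT; apply/ffun_onP => y; apply: imset_f.
have -> : f @: [set: Y] = A.
  apply/eqP; rewrite eqEcard card_imset ?cardsT ?cA ?leqnn ?andbT; last exact/injectiveP.
  by apply/subsetP => _ /imsetP[y _ ->].
by rewrite fi aA dA eqxx.
Qed.
End Embeddings.

(** * Embeddings of disjoint unions *)

Section DisjointSum.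
Variables (Y1 Y2 Z : finType).
Implicit Types p q g : {perm Z}.

Definition sum_map (s1 : {perm Y1}) (s2 : {perm Y2}) (u : Y1 + Y2) : Y1 + Y2 :=
  match u with inl y => inl (s1 y) | inr y => inr (s2 y) end.

Lemma sum_map_inj (s1 : {perm Y1}) (s2 : {perm Y2}) : injective (sum_map s1 s2).
Proof. by move=> [x|x] [y|y] //= [/perm_inj->]. Qed.

Definition sum_perm (s1 : {perm Y1}) (s2 : {perm Y2}) : {perm Y1 + Y2} := perm (@sum_map_inj s1 s2).

Definition sum_ffun (f1 : {ffun Y1 -> Z}) (f2 : {ffun Y2 -> Z}) : {ffun Y1 + Y2 -> Z} :=
  [ffun u => match u with inl y => f1 y | inr y => f2 y end].

Lemma sum_ffun_Einj (s1 : {perm Y1}) (s2 : {perm Y2}) g f1 f2 :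
  (sum_ffun f1 f2 \in Einj (sum_perm s1 s2) g) =
  [&& f1 \in Einj s1 g, f2 \in Einj s2 g &
      [disjoint f1 @: [set: Y1] & f2 @: [set: Y2]]].
Proof.
apply/EinjP/and3P => [[fi fe]|[/EinjP[i1 e1] /EinjP[i2 e2] d]].
  split.
  - apply/EinjP; split => [x y e|y]; last by have := fe (inl y); rewrite permE !ffunE.
    by have := fi (inl x) (inl y); rewrite !ffunE => /(_ e) [].
  - apply/EinjP; split => [x y e|y]; last by have := fe (inr y); rewrite permE !ffunE.
    by have := fi (inr x) (inr y); rewrite !ffunE => /(_ e) [].
  - rewrite disjoint_subset; apply/subsetP => _ /imsetP[x _ ->]; rewrite inE.
    apply/imsetP => -[y _ e].
    by have := fi (inl x) (inr y); rewrite !ffunE => /(_ e).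
have ne x y : f1 x <> f2 y.
  move=> e; have := disjointFr d (imset_f f1 (in_setT x)).
  by rewrite e imset_f.
split => [[x|x] [y|y]|[y|y]]; rewrite ?permE !ffunE //=.
- by move/i1->.
- by move/ne.
- by move/esym/ne.
- by move/i2->.
Qed.

(** Restriction to the two summands is a bijection from maps to pairs of maps; injectivity of the
    glued map is what forces disjoint images. *)
Lemma card_Einj_sum2 (s1 t1 : {perm Y1}) (s2 t2 : {perm Y2}) p q :
  #|Einj (sum_perm s1 s2) p :&: Einj (sum_perm t1 t2) q| =
  \sum_(f2 in Einj s2 p :&: Einj t2 q)
    #|[set f1 in Einj s1 p :&: Einj t1 q | [disjoint f1 @: [set: Y1] & f2 @: [set: Y2]]]|.
Proof.
pose h (f : {ffun Y1 + Y2 -> Z}) : {ffun Y1 -> Z} * {ffun Y2 -> Z} :=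
  ([ffun y => f (inl y)], [ffun y => f (inr y)]).
pose k (c : {ffun Y1 -> Z} * {ffun Y2 -> Z}) := sum_ffun c.1 c.2.
have hK : cancel h k by move=> f; apply/ffunP => -[y|y]; rewrite !ffunE.
have kK : cancel k h.
  by move=> [f1 f2]; congr (_, _); apply/ffunP => y; rewrite !ffunE.
rewrite -sum1_card (reindex k) /=; last by exists h => ? _; [apply: kK|apply: hK].
rewrite (eq_bigr (fun f2 : {ffun Y2 -> Z} => \sum_(f1 : {ffun Y1 -> Z} | f1 \in [set f1 in Einj s1 p :&: Einj t1 q |
   [disjoint f1 @: [set: Y1] & f2 @: [set: Y2]]]) 1)); last by move=> f2 _; rewrite sum1_card.
rewrite (exchange_big_dep predT) //= pair_big_dep /=; apply: eq_bigl => -[f1 f2] /=.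
rewrite in_setI !sum_ffun_Einj.
move: (Einj s1 p) (Einj t1 q) (Einj s2 p) (Einj t2 q) => A B C D; rewrite !inE.
by case: (f1 \in A); case: (f1 \in B); case: (f2 \in C);
  case: (f2 \in D); rewrite /= ?andbF ?andbb.
Qed.

Lemma card_Einj_sum (s1 : {perm Y1}) (s2 : {perm Y2}) g :
  #|Einj (sum_perm s1 s2) g| =
  \sum_(f2 in Einj s2 g)
    #|[set f1 in Einj s1 g | [disjoint f1 @: [set: Y1] & f2 @: [set: Y2]]]|.
Proof. by have := card_Einj_sum2 s1 s1 s2 s2 g g; rewrite !setIid. Qed.

Lemma card_Einj_sum_le (s1 : {perm Y1}) (s2 : {perm Y2}) g :
  #|Einj (sum_perm s1 s2) g| <= #|Einj s1 g| * #|Einj s2 g|.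
Proof.
rewrite card_Einj_sum mulnC -sum_nat_const; apply: leq_sum => f2 _.
by apply: subset_leq_card; apply/subsetP => f; rewrite in_set => /andP[].
Qed.

(* The error term counts the pairs of embeddings whose images collide. *)
Lemma card_Einj_sum_ge (s1 : {perm Y1}) (s2 : {perm Y2}) g (V : Y1 -> nat) :
  (forall x z, #|[set f in Einj s1 g | f x == z]| <= V x) ->
  #|Einj s1 g| * #|Einj s2 g| <=
  #|Einj (sum_perm s1 s2) g| + #|Y2| * #|Einj s2 g| * \sum_x V x.
Proof.
move=> VP; rewrite card_Einj_sum.
have -> : #|Einj s1 g| * #|Einj s2 g| = \sum_(f2 in Einj s2 g) #|Einj s1 g|.
  by rewrite sum_nat_const mulnC.
have -> : #|Y2| * #|Einj s2 g| * \sum_x V x = \sum_(f2 in Einj s2 g) (#|Y2| * \sum_x V x).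
  by rewrite sum_nat_const mulnCA mulnA.
rewrite -big_split; apply: leq_sum => f2 _ /=.
set D := [set f1 in _ | _].
rewrite -(cardsID D (Einj s1 g)); apply: leq_add.
  by apply: subset_leq_card; apply/subsetP => f; rewrite in_set => /andP[].
(* Union bound over the place of a collision: an [f1] outside [D] agrees at some [x] with [f2] at
   some [y]. *)
apply: (@leq_trans (\sum_(y : Y2) \sum_(x : Y1) #|[set f in Einj s1 g | f x == f2 y]|)); last first.
  have -> : #|Y2| * \sum_x V x = \sum_(y : Y2) \sum_x V x by rewrite sum_nat_const.
  by apply: leq_sum => y _; apply: leq_sum => x _; apply: VP.
have cE y x : #|[set f in Einj s1 g | f x == f2 y]| = \sum_(f in Einj s1 g) (f x == f2 y : nat).
  rewrite -sum1_card big_mkcond [RHS]big_mkcond; apply: eq_bigr => f _.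
  by rewrite in_set; case: (f \in _); case: eqP.
under eq_bigr => y _ do under eq_bigr => x _ do rewrite cE.
under eq_bigr => y _ do rewrite exchange_big.
rewrite exchange_big -sum1_card [X in _ <= X]big_mkcond [X in X <= _]big_mkcond; apply: leq_sum => f _.
case: ifP => // /setDP[fE]; rewrite in_set fE /= disjoint_subset => /subsetPn[_ /imsetP[x _ ->]].
rewrite inE negbK => /imsetP[y _ e].
by rewrite (bigD1 y) //= (bigD1 x) //= e eqxx.
Qed.
End DisjointSum.

(** * Counting equivariant injections cycle by cycle *)

Section CycleBounds.
Variables (Y Z : finType).
Implicit Types (s : {perm Y}) (g : {perm Z}).

(** Counts points rather than cycles: this is the number of possible images of a chosen point of a
    [j]-cycle. *)
Definition cycle_points g j := #|[set z | #|porbit g z| == j]|.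

Lemma Einj_iter s g f i y : f \in Einj s g -> f ((s ^+ i)%g y) = (g ^+ i)%g (f y).
Proof.
case/EinjP=> _ fe; elim: i => [|i IH]; first by rewrite !expg0 !perm1.
by rewrite !expgSr !permM fe IH.
Qed.

Lemma card_porbit_Einj s g f y : f \in Einj s g -> #|porbit g (f y)| = #|porbit s y|.
Proof.
move=> fE; have /EinjP[fi _] := fE.
rewrite -(card_imset _ fi); apply: eq_card => z; apply/porbitP/imsetP => [[i ->]|[_ /porbitP[i ->] ->]].
  by exists ((s ^+ i)%g y); rewrite ?mem_porbit // (Einj_iter _ _ fE).
by exists i; rewrite (Einj_iter _ _ fE).
Qed.

(* An equivariant map is determined by its value at one point of each cycle. *)
Lemma card_Einj_sub_le s g (E : {set {ffun Y -> Z}}) (Q : {set {set Y}}) :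
  E \subset Einj s g -> Q \subset porbits s ->
  {in E &, forall f1 f2 : {ffun Y -> Z}, forall x, porbit s x \notin Q -> exists2 y, y \in porbit s x & f1 y = f2 y} ->
  #|E| <= \prod_(O in Q) cycle_points g #|O|.
Proof.
move=> sE sQ det.
(* [h f] records the image of one representative of each cycle in [Q]. The value [None] off [Q]
   places it in a [pfamily], whose cardinality is the required product. *)
pose h (f : {ffun Y -> Z}) : {ffun {set Y} -> option Z} :=
  [ffun O : {set Y} => if O \in Q then omap f [pick y in O] else None].
have hi : {in E &, injective h}.
  move=> f1 f2 E1 E2 /ffunP eh; apply/ffunP => x.
  have [y yx ey] : exists2 y, y \in porbit s x & f1 y = f2 y.
    have [xQ|/det] := boolP (porbit s x \in Q); last exact.
    have := eh (porbit s x); rewrite !ffunE xQ; case: pickP => [y yx [e]|/(_ x)]; first by exists y.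
    by rewrite porbit_id.
  move: yx; rewrite porbit_sym => /porbitP[i ->].
  by rewrite !(Einj_iter _ _ (subsetP sE _ _)) ?ey.
rewrite -(card_in_imset hi).
pose F (O : {set Y}) : {set option Z} := Some @: [set z | #|porbit g z| == #|O|].
have -> : \prod_(O in Q) cycle_points g #|O| = #|pfamily None (mem Q) (fun O => mem (F O))|.
  rewrite card_pfamily foldrE big_map big_enum; apply: eq_bigr => O _.
  by rewrite card_imset //; exact: Some_inj.
apply/subset_leq_card/subsetP => _ /imsetP[f fE ->].
apply/pfamilyP; split => [|O OQ].
  by apply/supportP => O /negbTE OQ; rewrite ffunE OQ.
rewrite ffunE OQ; have /imsetP[x _ eO] := subsetP sQ _ OQ.
case: pickP => [y yO|/(_ x)]; last by rewrite eO porbit_id.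
rewrite /= imset_f // inE (card_porbit_Einj _ (subsetP sE _ fE)).
by move: yO; rewrite eO -eq_porbit_mem => /eqP->.
Qed.

Lemma card_Einj_le s g : #|Einj s g| <= \prod_(O in porbits s) cycle_points g #|O|.
Proof.
by apply: (card_Einj_sub_le (s := s)) => // f1 f2 _ _ x; rewrite imset_f.
Qed.

(** Prescribing the value at [x] determines the map on the whole cycle of [x], so that cycle
    contributes no factor. *)
Lemma card_Einj_at_le s g x z :
  #|[set f in Einj s g | f x == z]| <=
  \prod_(O in porbits s :\ porbit s x) cycle_points g #|O|.
Proof.
apply: (card_Einj_sub_le (s := s)); first by apply/subsetP => f; rewrite inE => /andP[].
  exact: subsetDl.
move=> f1 f2; rewrite !inE => /andP[_ /eqP e1] /andP[_ /eqP e2] y.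
rewrite !inE imset_f // andbT negbK => /eqP->.
by exists x; rewrite ?porbit_id // e1 e2.
Qed.
End CycleBounds.

(** * Cycles of transitive pairs *)

Section EulerBound.
Local Open Scope ring_scope.
Import GRing.Theory.
Variable k : nat.
Implicit Types s t : {perm 'I_k}.

(** The rows are the indicator vectors of the cycles; they span the vectors fixed by [s]. *)
Definition cycle_mx s : 'M[rat]_(#|porbits s|, k) :=
  \matrix_(i < #|porbits s|, j < k) (j \in (enum_val i : {set _}))%:R.

Lemma mem_porbits_perm s (O : {set 'I_k}) x : O \in porbits s -> (s x \in O) = (x \in O).
Proof.
case/imsetP=> y _ ->; rewrite -!eq_porbit_mem.
by have := porbit_perm s 1 x; rewrite expg1 => ->.
Qed.

(** Evaluating at one representative per cycle gives a right inverse, so the rows are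
    independent. *)
Lemma rank_cycle_mx s : \rank (cycle_mx s) = #|porbits s|.
Proof.
have [r rE] : exists r : 'I_#|porbits s| -> 'I_k,
    forall i, (enum_val i : {set _}) = porbit s (r i).
  have ex (i : 'I_#|porbits s|) : exists x, (enum_val i : {set _}) == porbit s x.
    by have /imsetP[x _ ->] := enum_valP i; exists x.
  by exists (fun i => xchoose (ex i)) => i; apply/eqP/(xchooseP (ex i)).
apply/eqP; rewrite -[_ == _]/(row_free _); apply/row_freeP.
exists (\matrix_(j < k, i < #|porbits s|) (j == r i)%:R); apply/matrixP => i i'.
rewrite !mxE (bigD1 (r i')) //= big1 => [|j /negbTE ne]; last first.
  by rewrite !mxE ne mulr0.
rewrite !mxE eqxx mulr1 addr0; congr (nat_of_bool _)%:R.
apply/idP/eqP => [|->]; last by rewrite rE porbit_id.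
by rewrite rE -eq_porbit_mem -!rE => /eqP/enum_val_inj.
Qed.

Lemma cycle_mx_perm s (w : 'rV[rat]_k) x : (w <= cycle_mx s)%MS -> w 0 (s x) = w 0 x.
Proof.
case/submxP=> u ->; rewrite !mxE; apply: eq_bigr => i _.
by rewrite !mxE mem_porbits_perm //; exact: enum_valP.
Qed.

(* Vectors fixed by s form a space of dimension #|porbits s|; only the constants are fixed by both s and t. *)
Lemma card_porbits_transitive s t :
  atom s t [set: 'I_k] -> (#|porbits s| + #|porbits t| <= k.+1)%N.
Proof.
move=> tr; have /set0Pn[x0 _] := atom_neq0 tr.
(* Dimension formula: the sum of the two row spaces has rank at most [k], so it remains to bound the
   rank of their intersection by 1. *)
rewrite -(rank_cycle_mx s) -(rank_cycle_mx t) -mxrank_sum_cap -addn1; apply: leq_add; first exact: rank_leq_col.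
suff le1 : (cycle_mx s :&: cycle_mx t <= (const_mx 1 : 'rV[rat]_k))%MS.
  exact: leq_trans (mxrankS le1) (rank_leq_row _).
apply/row_subP => i; set w := row i _.
have [ws wt] : (w <= cycle_mx s)%MS /\ (w <= cycle_mx t)%MS.
  by apply/andP; rewrite -sub_capmx; exact: row_sub.
have wc x : w 0 x = w 0 x0.
  (* The level set of [w] through [x0] is stable under both permutations, hence everything by
     minimality. *)
  have : [set y | w 0 y == w 0 x0] = [set: 'I_k].
    apply: (atom_min tr); rewrite ?subsetT //; first by apply/set0Pn; exists x0; rewrite inE.
    by apply/stable2P => y; rewrite !inE (cycle_mx_perm _ ws) (cycle_mx_perm _ wt).
  by move/setP/(_ x); rewrite !inE => /eqP.
apply/submxP; exists (const_mx (w 0 x0)); apply/rowP => x.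
by rewrite [LHS]wc !mxE big_ord1 !mxE mulr1.
Qed.
End EulerBound.

(** * Averages over conjugacy classes and disjoint unions of transitive pairs *)

Definition natoms (T : finType) (p q : {perm T}) (P : pred nat) : nat :=
  #|[set A | atom p q A & P #|A|]|.

Section Conjugation.
Variable T : finType.
Implicit Types (p q g h u v : {perm T}) (F : {perm T} -> {perm T} -> nat).

(** The map [u] is itself an embedding of [(p, q)] into the conjugated pair, hence carries atoms to
    atoms. *)
Lemma natoms_conj p q u (P : pred nat) : natoms (p ^ u) (q ^ u) P = natoms p q P.
Proof.
pose f : {ffun T -> T} := [ffun x => u x].
have fE s : f \in Einj s (s ^ u)%g.
  apply/EinjP; split => [x y|y]; rewrite !ffunE; first by move/perm_inj.
  by rewrite conjgE !permM permK.
have fi : injective f by have /EinjP[] := fE p.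
rewrite /natoms -[RHS](card_imset _ (imset_inj fi)); apply: eq_card => A.
have eA : A = f @: (f @^-1: A).
  apply/setP => x; apply/idP/imsetP => [xA|[y + ->]]; last by rewrite inE.
  by exists ((u^-1)%g x); rewrite ?inE ffunE permKV.
rewrite inE eA (atom_imset _ (fE p) (fE q)) card_imset // mem_imset; last exact: imset_inj.
by rewrite inE.
Qed.

(** The [v] giving the same conjugate of [g] form a coset of the centralizer, whose index is the
    size of the class. *)
Lemma sum_class_conj g (F : {perm T} -> nat) :
  #|[set: {perm T}]| * \sum_(p in (g ^: [set: {perm T}])%g) F p =
  #|(g ^: [set: {perm T}])%g| * \sum_(v : {perm T}) F (g ^ v)%g.
Proof.
set C := (g ^: _)%g.
rewrite [X in _ = _ * X](partition_big (fun v => (g ^ v)%g) (mem C)) /=; last first.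
  by move=> v _; apply: memJ_class; rewrite inE.
rewrite !big_distrr /=; apply: eq_bigr => _ /imsetP[w _ ->].
under eq_bigr => v /eqP -> do [].
rewrite sum_nat_const mulnA; congr (_ * _).
have -> : #|[pred v | (g ^ v)%g == (g ^ w)%g]| = #|'C[g]%g|.
  rewrite -(card_rcoset _ w); apply: eq_card => v; rewrite mem_rcoset unfold_in /=.
  rewrite cent1C cent1E conjgC (inj_eq (mulgI _)).
  by rewrite -{1}(mulgKV w v) conjgM (inj_eq (conjg_inj w)).
by rewrite [RHS]mulnC /C -index_cent1 setTI Lagrange ?subsetT.
Qed.

(** Conjugating both arguments shows that the inner sum is the same for every [p] in the class, so
    [p] may be fixed at [g]. *)
Lemma sum_class_pair g h F :
  (forall p q u, F (p ^ u)%g (q ^ u)%g = F p q) ->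
  #|[set: {perm T}]| *
    \sum_(p in (g ^: [set: {perm T}])%g) \sum_(q in (h ^: [set: {perm T}])%g) F p q =
  #|(g ^: [set: {perm T}])%g| * #|(h ^: [set: {perm T}])%g| * \sum_(v : {perm T}) F g (h ^ v)%g.
Proof.
move=> FJ; rewrite -mulnA -sum_class_conj mulnCA; congr (_ * _).
rewrite -sum_nat_const; apply: eq_bigr => _ /imsetP[u _ ->].
rewrite (reindex_inj (conjg_inj u)) /=; apply: eq_big => q; last by rewrite FJ.
by rewrite class_sym classGidl ?inE // class_sym.
Qed.
End Conjugation.

(** * Peeling off orbits one at a time *)

Section Saturation.
Import GRing.Theory Num.Theory.
Variable M : nat.

(* Every embedding of (s, t) covers exactly r atoms of size at most M. *)
Definition saturated (r : nat) (Y : finType) (s t : {perm Y}) :=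
  forall (Z : finType) (p q : {perm Z}) (f : {ffun Y -> Z}),
    f \in Einj s p -> f \in Einj t q ->
    #|[set A | [&& atom p q A, #|A| <= M & [disjoint A & f @: [set: Y]]]]| + r =
    natoms p q (fun k => k <= M).

Lemma saturated0 : saturated 0 (1%g : {perm void}) 1%g.
Proof.
move=> Z p q f _ _; rewrite addn0; apply: eq_card => A; rewrite !inE.
suff -> : f @: [set: void] = set0 by rewrite disjoint_sym -setI_eq0 set0I eqxx andbT.
by apply/eqP; rewrite -subset0; apply/subsetP => _ /imsetP[[]].
Qed.

(** The image of the added transitive piece is one atom of size at most [M]; every other atom is
    disjoint from it, so exactly one more atom is used up. *)
Lemma saturated_sum r (Y1 Y2 : finType) (s1 t1 : {perm Y1}) (s2 t2 : {perm Y2}) :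
  #|Y1| <= M -> atom s1 t1 [set: Y1] -> saturated r s2 t2 ->
  saturated r.+1 (sum_perm s1 s2) (sum_perm t1 t2).
Proof.
move=> kM a1 sat2 Z p q f.
pose f1 : {ffun Y1 -> Z} := [ffun y => f (inl y)].
pose f2 : {ffun Y2 -> Z} := [ffun y => f (inr y)].
have -> : f = sum_ffun f1 f2 by apply/ffunP => -[y|y]; rewrite !ffunE.
rewrite !sum_ffun_Einj => /and3P[s1E s2E d12] /and3P[t1E t2E _].
rewrite -(sat2 _ _ _ _ s2E t2E) addnS -addSn; congr (_ + r).
have aI : atom p q (f1 @: [set: Y1]) by rewrite (atom_imset _ s1E t1E).
have imE : sum_ffun f1 f2 @: [set: Y1 + Y2] = f1 @: [set: Y1] :|: f2 @: [set: Y2].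
  apply/setP => z; apply/imsetP/setUP => [[[y|y] _ ->]|[] /imsetP[y _ ->]].
  - by left; rewrite ffunE; apply: imset_f; rewrite inE.
  - by right; rewrite ffunE; apply: imset_f; rewrite inE.
  - by exists (inl y); rewrite ?inE // [RHS]ffunE.
  - by exists (inr y); rewrite ?inE // [RHS]ffunE.
set D := [set A : {set Z} | [&& _, _ & [disjoint A & f2 @: _]]].
have ID : f1 @: [set: Y1] \in D.
  by rewrite inE aI d12 andbT /=; apply: leq_trans kM; rewrite -cardsT leq_imset_card.
rewrite (cardsD1 (f1 @: [set: Y1]) D) ID add1n; congr _.+1; apply: eq_card => A.
rewrite !inE imE -!setI_eq0 setIUr setU_eq0 !setI_eq0.
case aA: (atom p q A); rewrite ?andbF //=; case: (_ <= M); rewrite ?andbF //=.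
congr (_ && _); have [->|nA] := eqVneq A (f1 @: [set: Y1]).
  by rewrite -setI_eq0 setIid (negbTE (atom_neq0 aI)).
by rewrite (atom_disjoint aA aI nA).
Qed.

(** Choosing one of the remaining atoms extends the embedding by a transitive pair on ['I_k], in
    [k!] labelled ways. Iterating this generates the falling factorials of the number of atoms. *)
Lemma saturated_step (R : numFieldType) r (Y Z : finType) (s t : {perm Y}) (p q : {perm Z}) :
  saturated r s t ->
  ((#|Einj s p :&: Einj t q| * (natoms p q (fun k => k <= M) - r))%N%:R =
  \sum_(k < M.+1) \sum_(c : {perm 'I_k} * {perm 'I_k} | atom c.1 c.2 [set: 'I_k])
     #|Einj (sum_perm c.1 s) p :&: Einj (sum_perm c.2 t) q|%:R / (k`!)%:R :> R)%R.
Proof.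
move=> sat.
have inner (k : 'I_M.+1) :
    (\sum_(c : {perm 'I_k} * {perm 'I_k} | atom c.1 c.2 [set: 'I_k])
      #|Einj (sum_perm c.1 s) p :&: Einj (sum_perm c.2 t) q|%:R / (k`!)%:R =
    (\sum_(f in Einj s p :&: Einj t q)
      #|[set A | [&& atom p q A, #|A| == k & [disjoint A & f @: [set: Y]]]]|)%N%:R :> R)%R.
  rewrite -mulr_suml -natr_sum.
  under eq_bigr => c _ do rewrite card_Einj_sum2.
  rewrite exchange_big /=.
  under eq_bigr => f _ do rewrite sum_card_transitive card_ord.
  rewrite -big_distrr /= natrM mulrC mulKf // pnatr_eq0 -lt0n fact_gt0 //.
rewrite (eq_bigr _ (fun k _ => inner k)) -natr_sum; congr (_%:R)%R.
rewrite exchange_big /= -sum_nat_const; apply: eq_bigr => f /setIP[fs ft].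
rewrite -(sat _ _ _ _ fs ft) addnK -sum1_card.
(* The atoms counted have size at most [M], so [inord] never falls back on its default here. *)
rewrite (partition_big (fun A : {set Z} => inord #|A| : 'I_M.+1) predT) //=.
apply: eq_bigr => k _; rewrite -sum1_card; apply: eq_bigl => A; rewrite !inE.
case: (atom p q A) => //=; have [leM|ltM] := leqP #|A| M; rewrite /=.
  by rewrite -val_eqE /= inordK // andbC.
by apply/esym/negbTE; rewrite negb_and neq_ltn (leq_trans (ltn_ord k)) // orbT.
Qed.
End Saturation.

(** * Invariant sets and their generating function *)

Section InvariantSets.
Variable T : finType.
Implicit Types (g h v : {perm T}) (A B : {set T}).

Definition inv_sets g k : {set {set T}} := [set A : {set T} | (g @: A == A) && (#|A| == k)].

Lemma atom_invariant p q A : atom p q A -> p @: A = A /\ q @: A = A.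
Proof.
move=> /atom_stable/stable2P sA; split; apply/eqP; rewrite eqEcard card_imset ?leqnn ?andbT;
  try exact: perm_inj; by apply/subsetP => _ /imsetP[x /sA[? ?] ->].
Qed.

(** Such a [v] is a bijection from [B] to [A] followed by an arbitrary extension to the
    complement. *)
Lemma card_perm_imset A B : #|A| = #|B| ->
  #|[set v : {perm T} | v @: B == A]| = #|B|`! * (#|T| - #|B|)`!.
Proof.
move=> cAB.
pose e (i : 'I_#|B|) : T := enum_val i.
have ei : injective e by exact: enum_val_inj.
have eB : e @: [set: 'I_#|B|] = B.
  apply/setP => x; apply/imsetP/idP => [[i _ ->]|xB]; first exact: enum_valP.
  by exists (enum_rank_in xB x); rewrite // /e enum_rankK_in.
pose h v : {ffun 'I_#|B| -> T} := [ffun i => v (e i)].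
rewrite -sum1_card (partition_big h (fun f => (f \in ffun_on (mem A)) && injectiveb f)) /=; last first.
  move=> v; rewrite inE => /eqP vB; apply/andP; split.
    by apply/ffun_onP => i; rewrite ffunE -vB; apply/imset_f/enum_valP.
  by apply/injectiveP => i j; rewrite !ffunE => /perm_inj/ei.
have -> : #|B|`! = #|[set f : {ffun 'I_#|B| -> T} in ffun_on (mem A) | injectiveb f]|.
  by rewrite card_inj_ffuns_on card_ord cAB ffactnn.
rewrite -sum_nat_const; apply: eq_big => [f|f /andP[/ffun_onP fA /injectiveP fi]].
  by rewrite inE.
rewrite -[#|B| in RHS](card_ord #|B|) -(card_perm_extend ei fi) sum1_card -cardsE.
apply: eq_card => v; rewrite !inE; apply/andP/forallP => [[_ /eqP<-] i|vE].
  by rewrite ffunE.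
have hf : h v = f by apply/ffunP => i; rewrite ffunE; apply/eqP.
split; last exact/eqP.
rewrite inE eqEcard card_imset ?cAB ?leqnn ?andbT; last exact: perm_inj.
apply/subsetP => _ /imsetP[x + ->]; rewrite -{1}eB => /imsetP[i _ ->].
by rewrite (eqP (vE i)); apply: fA.
Qed.

(** An atom [A] of [g] and [h ^ v] is invariant under [g], and its preimage under [v] is invariant
    under [h]. The sum over [v] is therefore bounded by counting triples [(A, B, v)] in which [v]
    maps [B] onto [A]. *)
Lemma sum_natoms_le g h k :
  \sum_(v : {perm T}) natoms g (h ^ v)%g (pred1 k) <=
  #|inv_sets g k| * #|inv_sets h k| * (k`! * (#|T| - k)`!).
Proof.
have step v : natoms g (h ^ v)%g (pred1 k) <=
    \sum_(A in inv_sets g k) \sum_(B in inv_sets h k) (v @: B == A).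
  rewrite /natoms -sum1_card big_mkcond [X in _ <= X]big_mkcond; apply: leq_sum => A _.
  case: ifP => //; rewrite inE => /andP[aA /eqP cA].
  have [gA hA] := atom_invariant aA.
  rewrite inE gA cA !eqxx /= (bigD1 ((v^-1)%g @: A)) /=; last first.
    rewrite inE card_imset ?cA ?eqxx ?andbT; last exact: perm_inj.
    apply/eqP; rewrite -[in RHS]hA -!imset_comp; apply: eq_imset => x /=.
    by rewrite conjgE !permM permK.
  rewrite -imset_comp (_ : _ @: A == A) //.
  by apply/eqP; rewrite -[RHS]imset_id; apply: eq_imset => x; rewrite /= permKV.
apply: (@leq_trans (\sum_(v : {perm T}) \sum_(A in inv_sets g k)
  \sum_(B in inv_sets h k) (v @: B == A))); first by apply: leq_sum => v _; exact: step.
rewrite exchange_big /= -!mulnA -sum_nat_const; apply: leq_sum => A.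
rewrite inE => /andP[_ /eqP cA]; rewrite exchange_big /= -sum_nat_const; apply: leq_sum => B.
rewrite inE => /andP[_ /eqP cB].
rewrite -{1 2}cB -(@card_perm_imset A B) ?cA ?cB // -sum1_card big_mkcond.
by rewrite [X in _ <= X]big_mkcond; apply: leq_sum => v _; rewrite inE; case: eqP.
Qed.
End InvariantSets.

Section GeneratingFunction.
Import Order.TTheory GRing.Theory Num.Theory.
Local Open Scope ring_scope.
Variables (R : numDomainType) (T : finType).
Implicit Types g : {perm T}.

Lemma inv_sets_cycles g (A : {set T}) x y :
  g @: A = A -> y \in porbit g x -> (y \in A) = (x \in A).
Proof.
move=> gA /porbitP[i ->]; elim: i => [|i IH]; first by rewrite expg0 perm1.
by rewrite expgSr permM -{1}gA mem_imset ?IH //; exact: perm_inj.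
Qed.

(** An invariant set is a union of cycles. Expanding the product gives one nonnegative term per set
    of cycles, and each invariant [k]-set accounts for its own term [x ^+ k]. *)
Lemma card_inv_sets_le g k (x : R) : 0 <= x ->
  #|inv_sets g k|%:R * x ^+ k <= \prod_(O in porbits g) (1 + x ^+ #|O|).
Proof.
move=> x0.
pose c (A : {set T}) : {set {set T}} := [set O in porbits g | O \subset A].
have memA A y : A \in inv_sets g k -> (y \in A) = (porbit g y \in c A).
  rewrite !inE => /andP[/eqP gA _]; rewrite imset_f //=.
  apply/idP/subsetP => [yA z zy|]; first by rewrite (inv_sets_cycles gA zy).
  by apply; apply: porbit_id.
have ci : {in inv_sets g k &, injective c}.
  by move=> A B iA iB e; apply/setP => y; rewrite (memA A) // (memA B) // e.
have wt A : A \in inv_sets g k -> \prod_(O in c A) x ^+ #|O| = x ^+ k.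
  move=> iA; rewrite prodrXr; congr (_ ^+ _).
  have /eqP <- : #|A| == k by move: iA; rewrite inE => /andP[].
  have coverA : cover (c A) = A.
    apply/setP => y; apply/bigcupP/idP => [[O + yO]|].
      by rewrite inE => /andP[_ /subsetP]; apply.
    by rewrite (memA A) // => ?; exists (porbit g y); rewrite // porbit_id.
  have triv : trivIset (c A).
    apply/trivIsetP => O1 O2; rewrite !inE => /andP[/imsetP[y1 _ ->] _] /andP[/imsetP[y2 _ ->] _].
    apply: contraR; rewrite -setI_eq0 => /set0Pn[z /setIP[]].
    by rewrite -!eq_porbit_mem => /eqP-> /eqP->.
  by rewrite -[in RHS]coverA; apply/eqP; move: triv; rewrite /trivIset.
have -> : \prod_(O in porbits g) (1 + x ^+ #|O|) =
    \sum_(J : {set {set T}} | J \subset porbits g) \prod_(O in J) x ^+ #|O|.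
  rewrite (eq_bigr (fun O : {set T} => x ^+ #|O| + 1)) => [|O _]; last by rewrite addrC.
  rewrite big_mkcond.
  (* The value 0 off [porbits g] lets the product run over all sets; after expansion only families
     of cycles contribute. *)
  rewrite (eq_bigr (fun O : {set T} => (if O \in porbits g then x ^+ #|O| else 0) + 1)); last first.
    by move=> O _; case: ifP; rewrite ?add0r.
  rewrite bigA_distr [RHS]big_mkcond; apply: eq_big => [J|J _]; first by rewrite inE.
  case: ifP => [sJ|/negbT/subsetPn[O OJ nO]].
    rewrite [RHS]big_mkcond; apply: eq_bigr => O _.
    by case: ifP => // /(subsetP sJ) ->.
  by rewrite (bigD1 O) //= OJ (negbTE nO) mul0r.
rewrite -sum1_card natr_sum mulr_suml.
under eq_bigr => A iA do rewrite mul1r -(wt A iA).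
rewrite -(big_imset (fun J : {set {set T}} => \prod_(O in J) x ^+ #|O|) ci) /=.
rewrite [leLHS]big_mkcond [leRHS]big_mkcond; apply: ler_sum => J _.
have nn : 0 <= \prod_(O in J) x ^+ #|O| by apply: prodr_ge0 => *; apply: exprn_ge0.
case: ifP => [/imsetP[A _ ->]|_]; last by case: ifP.
by rewrite ifT //; apply/subsetP => O; rewrite inE => /andP[].
Qed.
End GeneratingFunction.

Lemma leq_expl m n e : m <= n -> m ^ e <= n ^ e.
Proof. by move=> mn; elim: e => // e IH; rewrite !expnS leq_mul. Qed.

(** * Cycle counts by length and bounds for transitive pairs *)

Section CycleCounts.
Variable T : finType.
Implicit Types (g : {perm T}) (O : {set T}) (Q : {set {set T}}).

Lemma sum_porbits g (P : pred {set T}) :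
  \sum_(O in porbits g | P O) #|O| = #|[set x | P (porbit g x)]|.
Proof.
rewrite -sum1_card (partition_big (porbit g) (fun O => (O \in porbits g) && P O)) /=; last first.
  by move=> x; rewrite inE => ->; rewrite imset_f.
apply: eq_bigr => O /andP[/imsetP[y _ ->] PO].
rewrite -sum1_card; apply: eq_bigl => x; rewrite inE -eq_porbit_mem.
by case: eqP => [->|]; rewrite ?PO ?andbF.
Qed.

Lemma sum_card_porbits g : \sum_(O in porbits g) #|O| = #|T|.
Proof.
have -> : #|T| = #|[set x | xpredT (porbit g x)]| by rewrite -cardsT; apply: eq_card => x; rewrite !inE.
by rewrite -(sum_porbits g xpredT); apply: eq_bigl => O; rewrite andbT.
Qed.

Lemma cycle_pointsE g j : cycle_points g j = j * #|[set O in porbits g | #|O| == j]|.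
Proof.
rewrite /cycle_points -(sum_porbits g (fun O => #|O| == j)) mulnC -sum_nat_const.
by apply: eq_big => [O|O /andP[_ /eqP]]; rewrite ?inE.
Qed.

Lemma cycle_points_le g j : cycle_points g j <= #|T|.
Proof. exact: max_card. Qed.

(** Used with three classes of lengths: 1, 2, and at least 3, the last being written [leq 3]. *)
Definition ncyc Q (P : pred nat) := \sum_(O in Q) (P #|O| : nat).

Lemma porbits_gt0 g O : O \in porbits g -> 0 < #|O|.
Proof. by case/imsetP=> x _ ->; rewrite lt0n card_porbit_neq0. Qed.

Lemma ncyc_card g Q : Q \subset porbits g ->
  ncyc Q (pred1 1) + ncyc Q (pred1 2) + ncyc Q (leq 3) = #|Q|.
Proof.
move=> sQ; rewrite -sum1_card -!big_split; apply: eq_bigr => O /(subsetP sQ)/porbits_gt0 /=.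
by case: #|O| => [|[|[|k]]].
Qed.

Lemma ncyc_weight Q :
  ncyc Q (pred1 1) + 2 * ncyc Q (pred1 2) + 3 * ncyc Q (leq 3) <= \sum_(O in Q) #|O|.
Proof.
rewrite !big_distrr -!big_split; apply: leq_sum => O _ /=.
by case: #|O| => [|[|[|k]]] //=; lia.
Qed.

Lemma ncyc_weight_eq Q : ncyc Q (leq 3) = 0 ->
  ncyc Q (pred1 1) + 2 * ncyc Q (pred1 2) = \sum_(O in Q) #|O|.
Proof.
move=> /eqP; rewrite sum_nat_eq0 => /forallP n3.
rewrite big_distrr -big_split; apply: eq_bigr => O OQ /=.
by have := n3 O; rewrite OQ; case: #|O| => [|[|[|k]]].
Qed.
End CycleCounts.

Section EmbeddingBounds.
Variables (Y T : finType).
Implicit Types (s : {perm Y}) (g : {perm T}) (Q : {set {set Y}}).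

(** Cycles of length at least 3 get the trivial bound [#|T|]; only lengths 1 and 2 are tracked, as
    only those are restricted by the hypotheses. *)
Lemma prod_cycle_points_le s g Q : Q \subset porbits s ->
  \prod_(O in Q) cycle_points g #|O| <=
  (maxn 1 (cycle_points g 1)) ^ ncyc Q (pred1 1) *
  (cycle_points g 2) ^ ncyc Q (pred1 2) * #|T| ^ ncyc Q (leq 3).
Proof.
move=> sQ; rewrite /ncyc !expn_sum -!big_split; apply: leq_prod => O OQ /=.
have := porbits_gt0 (subsetP sQ _ OQ); have := cycle_points_le g #|O|.
case: #|O| => [|[|[|k]]] //= le _; rewrite ?expn0 ?expn1 ?muln1 ?mul1n //.
exact: leq_maxr.
Qed.
End EmbeddingBounds.

Section TransitiveBounds.
Variables (k : nat) (s t : {perm 'I_k}) (T : finType) (g h : {perm T}).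
Hypothesis tr : atom s t [set: 'I_k].
Let n := #|T|.
Let a := maxn 1 (cycle_points g 1).
Let a' := maxn 1 (cycle_points h 1).

(* After removing a cycle of s at most k cycles remain, so each factor can be charged to a power of n; since the removed cycle leaves weight less than 2 k, one of them is a fixed point or there are at most k - 1 cycles, which gains A / n. *)
Lemma prod_cycle_points_remove x A : a <= A -> a' <= A -> A <= n ->
  n * (\prod_(O in porbits s :\ porbit s x) cycle_points g #|O| *
       \prod_(O in porbits t) cycle_points h #|O|) <= A * n ^ k.
Proof.
move=> aA a'A An.
have A1 : 0 < A by apply: leq_trans aA; rewrite leq_max.
have n1 : 0 < n by apply: leq_trans An.
have eul := card_porbits_transitive tr.
set Q := porbits s :\ _; have sQ : Q \subset porbits s by exact: subsetDl.
have xs : porbit s x \in porbits s by exact: imset_f.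
have cQ : #|Q|.+1 = #|porbits s| by rewrite (cardsD1 (porbit s x) (porbits s)) xs.
have wQ : (\sum_(O in Q) #|O|).+1 <= k.
  have := sum_card_porbits s; rewrite card_ord (big_setD1 _ xs) /= => e; rewrite -[X in _ <= X]e.
  by rewrite -add1n leq_add2r lt0n card_porbit_neq0.
have wt : \sum_(O in porbits t) #|O| = k by rewrite sum_card_porbits card_ord.
have := ncyc_card sQ; have := ncyc_card (subxx (porbits t)).
have := ncyc_weight Q; have := ncyc_weight (porbits t).
have := prod_cycle_points_le g sQ; have := prod_cycle_points_le h (subxx (porbits t)).
rewrite -/a -/a' -/n {}wt.
move: (ncyc Q _) (ncyc Q _) (ncyc Q _) => e3 e2 e1.
move: (ncyc _ _) (ncyc _ _) (ncyc _ _) => f3 f2 f1.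
move=> Pt Ps wt wQ' ct cQ'.
move: (\sum_(O in Q) #|O|) wQ wQ' => S wQ wQ'.
move: (#|Q|) (#|porbits s|) (#|porbits t|) eul cQ ct cQ' => q1 q2 q3 eul cQ ct cQ'.
have le : \prod_(O in Q) cycle_points g #|O| * \prod_(O in porbits t) cycle_points h #|O| <=
    A ^ (e1 + f1) * n ^ (e2 + e3 + f2 + f3).
  apply: (leq_trans (leq_mul Ps Pt)).
  have -> : A ^ (e1 + f1) * n ^ (e2 + e3 + f2 + f3) =
     (A ^ e1 * n ^ e2 * n ^ e3) * (A ^ f1 * n ^ f2 * n ^ f3) by rewrite !expnD; lia.
  by apply: leq_mul; (apply: leq_mul; last exact: leqnn);
    apply: leq_mul; apply: leq_expl => //; exact: cycle_points_le.
apply: (leq_trans (leq_mul (leqnn n) le)).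
case E : (e1 + f1) => [|e].
  rewrite expn0 mul1n -expnS; apply: (@leq_trans (n ^ k)); last exact: leq_pmull.
  by rewrite leq_pexp2l //; lia.
have -> : n * (A ^ e.+1 * n ^ (e2 + e3 + f2 + f3)) = A * (A ^ e * n ^ (e2 + e3 + f2 + f3).+1).
  by rewrite !expnS; lia.
rewrite leq_pmul2l //; apply: (@leq_trans (n ^ e * n ^ (e2 + e3 + f2 + f3).+1)).
  by rewrite leq_mul // leq_expl.
by rewrite -expnD leq_pexp2l //; lia.
Qed.

(* If all cycles have length at most 2 then (s, t) is a path or a cycle and there are at most two fixed points in total; otherwise A ^ 3 <= n ^ 2 suffices. *)
Lemma prod_cycle_points_transitive A K : 0 < n -> 0 < K ->
  a <= A -> a' <= A -> A ^ 3 <= n ^ 2 -> a * a' <= K * n ->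
  a ^ 2 * cycle_points h 2 <= K * n ^ 2 -> a' ^ 2 * cycle_points g 2 <= K * n ^ 2 ->
  \prod_(O in porbits s) cycle_points g #|O| *
  \prod_(O in porbits t) cycle_points h #|O| <= K * n ^ k.
Proof.
move=> n1 K1 aA a'A A3 aa' aah aag.
have eul := card_porbits_transitive tr.
have ws : \sum_(O in porbits s) #|O| = k by rewrite sum_card_porbits card_ord.
have wt : \sum_(O in porbits t) #|O| = k by rewrite sum_card_porbits card_ord.
have := ncyc_card (subxx (porbits s)); have := ncyc_card (subxx (porbits t)).
have := ncyc_weight (porbits s); have := ncyc_weight (porbits t).
have := @ncyc_weight_eq _ (porbits s); have := @ncyc_weight_eq _ (porbits t).
have := prod_cycle_points_le g (subxx (porbits s)).
have := prod_cycle_points_le h (subxx (porbits t)).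
rewrite -/a -/a' -/n {}wt {}ws.
move: (ncyc (porbits s) (pred1 1)) (ncyc (porbits s) (pred1 2)) (ncyc (porbits s) (leq 3)) => e1 e2 e3.
move: (ncyc (porbits t) (pred1 1)) (ncyc (porbits t) (pred1 2)) (ncyc (porbits t) (leq 3)) => f1 f2 f3.
move: (#|porbits s|) (#|porbits t|) eul => q1 q2 eul Pt Ps wt_eq ws_eq wt ws ct cs.
have b2 : cycle_points g 2 <= n by exact: cycle_points_le.
have b2' : cycle_points h 2 <= n by exact: cycle_points_le.
apply: (leq_trans (leq_mul Ps Pt)).
have [/eqP|E3] := posnP (e3 + f3).
  rewrite addn_eq0 => /andP[/eqP e30 /eqP f30]; subst e3 f3.
  have {ws_eq}ws' := ws_eq erefl; have {wt_eq}wt' := wt_eq erefl.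
  rewrite !expn0 !muln1.
  have pow m : cycle_points g 2 ^ m <= n ^ m by exact: leq_expl.
  have pow' m : cycle_points h 2 ^ m <= n ^ m by exact: leq_expl.
  (* Both weights equal [k], so the total number of cycles is [k + (e1 + f1) / 2], which is at most
     [k + 1]. Moreover [e1] and [f1] have the same parity. *)
  have cases : [\/ e1 = 0 /\ f1 = 0, e1 = 1 /\ f1 = 1, e1 = 2 /\ f1 = 0 | e1 = 0 /\ f1 = 2].
    have : e1 + f1 <= 2 by lia.
    case: e1 ws ws' cs {Ps} => [|[|[|e1]]]; case: f1 wt wt' ct {Pt} => [|[|[|f1]]] // *; try lia;
      try (by constructor 1); try (by constructor 2); try (by constructor 3); try (by constructor 4).
  case: cases => -[? ?]; subst e1 f1; rewrite ?expn0 ?mul1n ?expn1.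
  - apply: (@leq_trans (n ^ e2 * n ^ f2)); first by rewrite leq_mul.
    by rewrite -expnD (_ : e2 + f2 = k) ?leq_pmull //; lia.
  - rewrite mulnACA; apply: (@leq_trans (K * n * (n ^ e2 * n ^ f2))); first by apply: leq_mul => //; apply: leq_mul.
    by rewrite -mulnA -expnD -expnS leq_mul // leq_pexp2l //; lia.
  (* Two fixed points of [s] force [k] to be at least 2, so [t] has a 2-cycle to pair them with in
     the mixed hypothesis. *)
  - case: f2 wt wt' ct {Pt} => [|f2] wt wt' ct; first lia.
    have -> : a ^ 2 * cycle_points g 2 ^ e2 * cycle_points h 2 ^ f2.+1 =
       a ^ 2 * cycle_points h 2 * (cycle_points g 2 ^ e2 * cycle_points h 2 ^ f2).
      by rewrite (expnS _ f2); lia.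
    apply: (@leq_trans (K * n ^ 2 * (n ^ e2 * n ^ f2))); first by apply: leq_mul => //; apply: leq_mul.
    by rewrite -mulnA -!expnD leq_mul // leq_pexp2l //; lia.
  - case: e2 ws ws' cs {Ps} => [|e2] ws ws' cs; first lia.
    have -> : cycle_points g 2 ^ e2.+1 * (a' ^ 2 * cycle_points h 2 ^ f2) =
       a' ^ 2 * cycle_points g 2 * (cycle_points g 2 ^ e2 * cycle_points h 2 ^ f2).
      by rewrite (expnS _ e2); lia.
    apply: (@leq_trans (K * n ^ 2 * (n ^ e2 * n ^ f2))); first by apply: leq_mul => //; apply: leq_mul.
    by rewrite -mulnA -!expnD leq_mul // leq_pexp2l //; lia.
apply: (@leq_trans (n ^ k)); last exact: leq_pmull.
apply: (@leq_trans (A ^ (e1 + f1) * n ^ (e2 + e3 + f2 + f3))).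
  have -> : A ^ (e1 + f1) * n ^ (e2 + e3 + f2 + f3) =
     (A ^ e1 * n ^ e2 * n ^ e3) * (A ^ f1 * n ^ f2 * n ^ f3) by rewrite !expnD; lia.
  by apply: leq_mul; (apply: leq_mul; last exact: leqnn);
    apply: leq_mul; apply: leq_expl.
(* After cubing, the exponent of [n] is [2 (e1 + f1) + 3 (e2 + e3 + f2 + f3)]. Adding the two weight
   inequalities to the bound on the number of cycles gives at most [3 k + 1 - (e3 + f3)], hence at
   most [3 k]. *)
rewrite -(@leq_exp2r _ _ 3) // expnMn -!expnM.
apply: (@leq_trans ((n ^ 2) ^ (e1 + f1) * n ^ ((e2 + e3 + f2 + f3) * 3))).
  by apply: leq_mul => //; rewrite mulnC expnM; apply: leq_expl.
by rewrite -expnM -expnD leq_pexp2l //; lia.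
Qed.
End TransitiveBounds.

From mathcomp Require Import all_classical all_reals all_analysis.
From mathcomp Require Import ring lra.
Import Order.TTheory GRing.Theory Num.Theory.
Import numFieldNormedType.Exports.

(** * Estimates for a fixed n *)

Section RealEstimates.
Local Open Scope ring_scope.
Variable R : realType.
Implicit Types x y z : R.

(** A crude Stirling upper bound; the induction step is [(1 + 1/m)^(m+1) >= e]. *)
Lemma fact_expR_le n : (0 < n)%N -> (n`!)%:R * expR n%:R <= expR 1 * n%:R ^+ n.+1 :> R.
Proof.
case: n => // n _; elim: n => [|n IH]; first by rewrite expr1n mulr1 mul1r.
set m := n.+1 in IH *.
have m0 : 0 < m%:R :> R by rewrite ltr0n.
have m10 : 0 < m.+1%:R :> R by rewrite ltr0n.

have key : m%:R ^+ m.+1 * expR 1 <= m.+1%:R ^+ m.+1 :> R.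
  have le1 : m%:R <= m.+1%:R * expR (- (m.+1%:R)^-1) :> R.
    apply: le_trans (_ : m.+1%:R * (1 - (m.+1%:R)^-1) <= _); last first.
      by rewrite ler_pM2l // expR_ge1Dx.
    by rewrite mulrBr mulr1 mulfV ?gt_eqF // -natr1 addrK.
  have := lerXn2r m.+1 (ler0n R m) (le_trans (ler0n R m) le1) le1.
  rewrite exprMn -expRM_natl mulrN divff ?gt_eqF // => le2.
  apply: le_trans (ler_wpM2r (expR_ge0 1) le2) _.
  by rewrite -mulrA -expRD addNr expR0 mulr1.
have -> : (m.+1`!)%:R * expR m.+1%:R = m.+1%:R * expR 1 * ((m`!)%:R * expR m%:R) :> R.
  by rewrite factS natrM -[in expR _](natr1 m) expRD; ring.
apply: le_trans (_ : m.+1%:R * expR 1 * (expR 1 * m%:R ^+ m.+1) <= _).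
  by rewrite ler_pM2l // mulr_gt0 ?expR_gt0.
have -> : m.+1%:R * expR 1 * (expR 1 * m%:R ^+ m.+1) =
    expR 1 * (m.+1%:R * (m%:R ^+ m.+1 * expR 1)) :> R by ring.
by rewrite ler_pM2l ?expR_gt0 // exprS ler_pM2l.
Qed.

Lemma expn_le_fact_expR n : n%:R ^+ n <= (n`!)%:R * expR n%:R :> R.
Proof.
case: n => [|n]; first by rewrite expr0 mul1r expR0.
rewrite mulrC -ler_pdivrMr ?ltr0n ?fact_gt0 //.
apply: le_trans (expR_ge1Dxn n (ler0n _ n.+1)).
by rewrite lerDr ler01.
Qed.

(** Stirling from below for [n!] and from above for [k!] and [(n - k)!]. *)
Lemma binomial_ge n k : (0 < k < n)%N ->
  n%:R ^+ n <= 'C(n, k)%:R * (expR 1 ^+ 2 * k%:R ^+ k.+1 * (n - k)%:R ^+ (n - k).+1) :> R.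
Proof.
case/andP => k0 kn; have nk0 : (0 < n - k)%N by rewrite subn_gt0.
apply: le_trans (expn_le_fact_expR n) _.
rewrite -(bin_fact (ltnW kn)) !natrM.
have -> : expR n%:R = expR k%:R * expR (n - k)%:R :> R.
  by rewrite -expRD -natrD subnKC // ltnW.
have -> : 'C(n, k)%:R * ((k`!)%:R * (n - k)`!%:R) * (expR k%:R * expR (n - k)%:R) =
  'C(n, k)%:R * (((k`!)%:R * expR k%:R) * ((n - k)`!%:R * expR (n - k)%:R)) :> R by ring.
rewrite ler_wpM2l ?ler0n //.
have -> : expR 1 ^+ 2 * k%:R ^+ k.+1 * (n - k)%:R ^+ (n - k).+1 =
  (expR 1 * k%:R ^+ k.+1) * (expR 1 * (n - k)%:R ^+ (n - k).+1) :> R by ring.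
by apply: ler_pM; rewrite ?mulr_ge0 ?ler0n ?expR_ge0 // fact_expR_le.
Qed.

Lemma expR_le1B u : 0 <= u <= 1 / 2 -> expR (- (2 * u)) <= 1 - u :> R.
Proof.
case/andP=> u0 u2; rewrite expRN -[leLHS]mul1r ler_pdivrMr ?expR_gt0 //.
apply: le_trans (_ : (1 - u) * (1 + 2 * u) <= _); first nra.
by rewrite ler_wpM2l ?expR_ge1Dx //; lra.
Qed.

(** Each factor of the falling factorial is at least [n (1 - k/n)], hence at least [n exp(- 2 b)];
    the remaining [k!] is bounded by Stirling. *)
Lemma binomial_inv_le (b : R) n k : (0 < k <= n)%N -> k%:R <= b * n%:R -> b <= 1 / 2 ->
  'C(n, k)%:R^-1 <=
  expR 1 * k%:R * (k%:R / n%:R) ^+ k * expR (- k%:R + 2 * b * k%:R) :> R.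
Proof.
case/andP=> k0 kn kb b2.
have n0 : 0 < n%:R :> R by rewrite ltr0n (leq_trans k0).
have kR : 0 < k%:R :> R by rewrite ltr0n.
have u0 : 0 <= k%:R / n%:R :> R by rewrite divr_ge0 ?ler0n.
have ub : k%:R / n%:R <= b :> R by rewrite ler_pdivrMr.
have ff : (n%:R * expR (- (2 * b))) ^+ k <= (n ^_ k)%:R :> R.
  rewrite ffact_prod natr_prod -[X in _ ^+ X]card_ord -prodr_const.
  apply: ler_prod => i _; rewrite mulr_ge0 ?expR_ge0 ?ler0n //=.
  apply: le_trans (_ : n%:R * (1 - k%:R / n%:R) <= _).
    rewrite ler_pM2l //; apply: le_trans (expR_le1B _); last by rewrite u0 (le_trans ub).
    by rewrite ler_expR; lra.
  rewrite mulrBr mulr1 mulrCA divff ?gt_eqF // mulr1 natrB; last by rewrite (leq_trans (ltnW (ltn_ord i))).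
  by rewrite lerB // ler_nat ltnW.
have ff0 : 0 < (n ^_ k)%:R :> R by rewrite ltr0n ffact_gt0.
have -> : 'C(n, k)%:R^-1 = (k`!)%:R / (n ^_ k)%:R :> R.
  have kf : (k`!)%:R != 0 :> R by rewrite pnatr_eq0 -lt0n fact_gt0.
  have cn : 'C(n, k)%:R != 0 :> R by rewrite pnatr_eq0 -lt0n bin_gt0.
  by rewrite -bin_ffact natrM; field; rewrite kf cn.
rewrite ler_pdivrMr //.
apply: le_trans (_ : expR 1 * k%:R * (k%:R / n%:R) ^+ k * expR (- k%:R + 2 * b * k%:R) *
   (n%:R * expR (- (2 * b))) ^+ k <= _); last first.
  by rewrite ler_wpM2l // ?mulr_ge0 ?exprn_ge0 ?expR_ge0 ?ler0n.
have -> : expR 1 * k%:R * (k%:R / n%:R) ^+ k * expR (- k%:R + 2 * b * k%:R) *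
   (n%:R * expR (- (2 * b))) ^+ k = expR 1 * k%:R ^+ k.+1 * expR (- k%:R) :> R.
  rewrite [expR (_ + _)]expRD !exprMn exprVn -expRM_natl.
  have -> : expR (2 * b * k%:R) = (expR (k%:R * - (2 * b)))^-1 by rewrite -expRN; congr expR; ring.
  have e0 : expR (k%:R * - (2 * b)) != 0 by rewrite gt_eqF ?expR_gt0.
  have nn : n%:R ^+ k != 0 :> R by rewrite expf_neq0 ?gt_eqF.
  by rewrite exprS; field; rewrite nn e0.
by rewrite expRN ler_pdivlMr ?expR_gt0 // fact_expR_le.
Qed.

(** For [j = 2] the powers agree with no gain. The case [j = 3] rests on [2 x^3 <= x^2 + x^4];
    raising [j] decreases the left side, while the right side is multiplied by
    [(1 + z) exp(- z / 12)], which is at least 1. *)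
Lemma sqr_one_plus_expr_le x j : 0 <= x <= 1 -> (2 < j)%N ->
  (1 + x ^+ j) ^+ 2 <= (1 + x ^+ 2) ^+ j * expR (- (x ^+ 2 / 12 * j%:R)).
Proof.
case/andP=> x0 x1; set z := x ^+ 2.
have z0 : 0 <= z by rewrite exprn_ge0.
have z1 : z <= 1 by rewrite exprn_ile1.
elim: j => // j IH; rewrite ltnS leq_eqVlt => /orP[/eqP<-|/IH {}IH].
  apply: le_trans (_ : (1 + z) ^+ 3 * (1 - z / 12 * 3) <= _); last first.
    by rewrite ler_wpM2l ?exprn_ge0 ?addr_ge0 // expR_ge1Dx.
  have -> : (1 + x ^+ 3) ^+ 2 = 1 + 2 * (x * z) + z ^+ 3 by rewrite /z; ring.
  have h : 2 * (x * z) <= z + z ^+ 2.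
    have -> : z + z ^+ 2 = 2 * (x * z) + (x * (1 - x)) ^+ 2 by rewrite /z; ring.
    by rewrite lerDl sqr_ge0.
  have : 0 <= z ^+ 2 <= 1 by rewrite exprn_ge0 //= exprn_ile1.
  have : 0 <= z ^+ 3 <= z ^+ 2 by rewrite exprn_ge0 //= ler_wiXn2l.
  have -> : (1 + z) ^+ 3 * (1 - z / 12 * 3) =
     1 + 3 * z + 3 * z ^+ 2 + z ^+ 3 - (z + 3 * z ^+ 2 + 3 * z ^+ 3 + z ^+ 4) / 4 by field.
  have : 0 <= z ^+ 4 <= z ^+ 3 by rewrite exprn_ge0 //= ler_wiXn2l.
  lra.
apply: le_trans (_ : (1 + x ^+ j) ^+ 2 <= _).
  apply: lerXn2r; rewrite ?nnegrE ?addr_ge0 ?exprn_ge0 // lerD2l.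
  by rewrite ler_wiXn2l.
apply: le_trans IH _.
have -> : z / 12 * j.+1%:R = z / 12 * j%:R + z / 12 by rewrite -(natr1 j); ring.
rewrite exprSr opprD expRD mulrACA ler_peMr //.
  by rewrite mulr_ge0 ?expR_ge0 ?exprn_ge0 ?addr_ge0.
apply: le_trans (_ : (1 + z) * (1 - z / 12) <= _); first nra.
by rewrite ler_wpM2l ?addr_ge0 // expR_ge1Dx.
Qed.
End RealEstimates.

(** * Estimates of the generating function *)

Section CycleGeneratingFunction.
Local Open Scope ring_scope.
Variable R : realType.

Lemma ncyclesE n (g : {perm 'I_n}) j : ncycles g j = ncyc (porbits g) (pred1 j).
Proof.
rewrite /ncycles /ncyc -sum1_card big_mkcond [RHS]big_mkcond; apply: eq_bigr => O _.
by rewrite inE; case: (O \in _) => //=; case: eqP.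
Qed.

Lemma ncyc_natr n (g : {perm 'I_n}) (P : pred nat) :
  (ncyc (porbits g) P)%:R = \sum_(O in porbits g) (P #|O|)%:R :> R.
Proof. by rewrite /ncyc natr_sum. Qed.

(** The coefficient of [x ^+ k] is the number of invariant [k]-sets. *)
Definition cycle_gf n (g : {perm 'I_n}) (x : R) : R :=
  \prod_(O in porbits g) (1 + x ^+ #|O|).

Lemma cycle_gf_ge0 n (g : {perm 'I_n}) x : 0 <= x -> 0 <= cycle_gf g x.
Proof. by move=> x0; apply: prodr_ge0 => O _; rewrite addr_ge0 ?exprn_ge0. Qed.

Lemma cycle_gf_le_exp n (g : {perm 'I_n}) (x : R) : 0 <= x <= 1 ->
  cycle_gf g x <=
  expR ((ncycles g 1)%:R * x + (ncycles g 2)%:R * x ^+ 2 + n%:R * x ^+ 3).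
Proof.
move=> /andP[x0 x1]; apply: le_trans (_ : \prod_(O in porbits g) expR (x ^+ #|O|) <= _).
  by apply: ler_prod => O _; rewrite expR_ge1Dx addr_ge0 ?exprn_ge0.
rewrite -expR_sum ler_expR.
apply: le_trans (_ : (ncycles g 1)%:R * x + (ncycles g 2)%:R * x ^+ 2 +
  (ncyc (porbits g) (leq 3))%:R * x ^+ 3 <= _).
  rewrite !ncyclesE !ncyc_natr !mulr_suml -!big_split; apply: ler_sum => O Og /=.
  have := porbits_gt0 Og; case: #|O| => [|[|[|j]]] //= _; rewrite ?mul0r ?mul1r ?addr0 ?add0r ?expr1 //.
  by rewrite ler_wiXn2l.
rewrite lerD2l ler_wpM2r ?exprn_ge0 // ler_nat.
rewrite -[X in (_ <= X)%N]card_ord -(sum_card_porbits g); apply: leq_sum => O /porbits_gt0.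
by case: #|O| => [|[|[|j]]].
Qed.

(** Compared cycle by cycle: a fixed point costs [exp 2], a transposition gives equality, and each
    point in a longer cycle gains [exp(- x^2 / 12)]. *)
Lemma cycle_gf_sqr_le n (g : {perm 'I_n}) (x : R) : 0 <= x <= 1 ->
  cycle_gf g x ^+ 2 <= (1 + x ^+ 2) ^+ n *
    expR (2 * (ncycles g 1)%:R -
      x ^+ 2 / 12 * (n%:R - (ncycles g 1)%:R - 2 * (ncycles g 2)%:R)).
Proof.
move=> /andP[x0 x1]; rewrite -prodrXl.
pose e (j : nat) : R := 2 * (j == 1)%:R - x ^+ 2 / 12 * (j%:R - (j == 1)%:R - 2 * (j == 2)%:R).
have -> : (1 + x ^+ 2) ^+ n * expR (2 * (ncycles g 1)%:R -
      x ^+ 2 / 12 * (n%:R - (ncycles g 1)%:R - 2 * (ncycles g 2)%:R)) =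
   \prod_(O in porbits g) ((1 + x ^+ 2) ^+ #|O| * expR (e #|O|)).
  rewrite big_split /= -expR_sum prodrXr sum_card_porbits card_ord; congr (_ * expR _).
  have -> : n%:R = \sum_(O in porbits g) #|O|%:R :> R.
    by rewrite -natr_sum sum_card_porbits card_ord.
  rewrite !ncyclesE !ncyc_natr.
  rewrite !mulr_sumr -!sumrB mulr_sumr -sumrB; apply: eq_bigr => O _.
  by rewrite /e /=.
apply: ler_prod => O Og; rewrite exprn_ge0 ?addr_ge0 ?exprn_ge0 //=.
have := porbits_gt0 Og; case: #|O| => [|[|[|j]]] // _; rewrite /e /=.
- rewrite expr1 subrr mulr0 !subr0 mulr0 subr0 mulr1 expr1.
  apply: le_trans (_ : expR 2 <= _); last first.
    by rewrite ler_peMl ?expR_ge0 // lerDl exprn_ge0.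
  have -> : expR 2 = expR 1 ^+ 2 :> R by rewrite -expRM_natl mulr1.
  apply: lerXn2r; rewrite ?nnegrE ?addr_ge0 ?expR_ge0 //.
  by apply: le_trans (expR_ge1Dx 1); rewrite lerD2l.
- by rewrite !mulr0 subr0 mulr1 subrr mulr0 subr0 expR0 mulr1.
- rewrite !mulr0 !subr0 sub0r; apply: sqr_one_plus_expr_le => //.
  by rewrite x0.
Qed.

Lemma inv_sets_gf_le n (g h : {perm 'I_n}) k (x y : R) : 0 < x -> 0 < y ->
  (#|inv_sets g k| * #|inv_sets h k|)%:R * (x * y) ^+ k <= cycle_gf g x * cycle_gf h y.
Proof.
move=> x0 y0; rewrite natrM exprMn mulrACA.
by apply: ler_pM; rewrite ?mulr_ge0 ?ler0n ?exprn_ge0 ?(ltW x0) ?(ltW y0) // card_inv_sets_le // ltW.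
Qed.
End CycleGeneratingFunction.

(** * Expected number of common invariant sets *)

Section InvariantSetBounds.
Local Open Scope ring_scope.
Variable R : realType.

(* Expected number of k-sets invariant under both g and a uniform conjugate of h. *)
Definition inv_set_mean n (g h : {perm 'I_n}) k : R :=
  (#|inv_sets g k| * #|inv_sets h k|)%:R / 'C(n, k)%:R.

Lemma inv_set_meanC n (g h : {perm 'I_n}) k : inv_set_mean g h k = inv_set_mean h g k.
Proof. by rewrite /inv_set_mean mulnC. Qed.

Lemma ncycles2_le n (g : {perm 'I_n}) : 2 * (ncycles g 2)%:R <= n%:R :> R.
Proof.
rewrite -natrM ler_nat ncyclesE -[X in (_ <= X)%N]card_ord -(sum_card_porbits g).
rewrite /ncyc big_distrr; apply: leq_sum => O _ /=.
by case: eqP => [->|].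
Qed.

(** With [x y = k / n] the power [(k / n)^k] from the binomial bound cancels; the split of this
    product between [x] and [y] stays free. *)
Lemma inv_set_mean_le n (g h : {perm 'I_n}) k (b x y : R) : (0 < k <= n)%N ->
  k%:R <= b * n%:R -> b <= 1 / 2 -> 0 < x <= 1 -> 0 < y <= 1 -> n%:R * (x * y) = k%:R ->
  inv_set_mean g h k <= expR 1 * k%:R * expR (- k%:R + 2 * b * k%:R +
    ((ncycles g 1)%:R * x + (ncycles g 2)%:R * x ^+ 2 + n%:R * x ^+ 3) +
    ((ncycles h 1)%:R * y + (ncycles h 2)%:R * y ^+ 2 + n%:R * y ^+ 3)).
Proof.
move=> kn kb b2 /andP[x0 x1] /andP[y0 y1] xy.
have [k0 lekn] := andP kn.
have n0 : 0 < n%:R :> R by rewrite ltr0n (leq_trans k0).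
have kR : 0 < k%:R :> R by rewrite ltr0n.
have xyE : x * y = k%:R / n%:R by rewrite -xy mulrAC mulfV ?mul1r ?gt_eqF.
have q0 : 0 < (k%:R / n%:R) ^+ k :> R by rewrite exprn_gt0 ?divr_gt0.
have := inv_sets_gf_le g h k x0 y0; rewrite xyE -ler_pdivlMr // => aa.
rewrite /inv_set_mean.
apply: le_trans (_ : (cycle_gf g x * cycle_gf h y / (k%:R / n%:R) ^+ k) *
   (expR 1 * k%:R * (k%:R / n%:R) ^+ k * expR (- k%:R + 2 * b * k%:R)) <= _).
  by apply: ler_pM => //; rewrite ?ler0n ?invr_ge0 ?ler0n // (binomial_inv_le (b := b)).
have -> : (cycle_gf g x * cycle_gf h y / (k%:R / n%:R) ^+ k) *
   (expR 1 * k%:R * (k%:R / n%:R) ^+ k * expR (- k%:R + 2 * b * k%:R)) =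
   expR 1 * k%:R * (expR (- k%:R + 2 * b * k%:R) * cycle_gf g x * cycle_gf h y).
  by move: q0; set q := _ ^+ k => q0; field; rewrite gt_eqF.
rewrite ler_pM2l ?mulr_gt0 ?expR_gt0 //.
set u := - _ + _; set p := (_ + _ + n%:R * x ^+ 3); set q := (_ + _ + n%:R * y ^+ 3).
rewrite [expR (u + p + q)]expRD [expR (u + p)]expRD -!mulrA ler_pM2l ?expR_gt0 //.
by apply: ler_pM; rewrite ?cycle_gf_ge0 ?cycle_gf_le_exp ?(ltW x0) ?(ltW y0) // ?x1 ?y1.
Qed.

(* Unbalanced case of the optimisation: g has so many fixed points that x must be taken smaller than sqrt (k / n), at the expense of y. *)
Lemma inv_set_mean_unbalanced n (g h : {perm 'I_n}) k (s K w : R) : (0 < k <= n)%N ->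
  0 < s <= 1 / 16 -> k%:R <= s ^+ 2 * n%:R -> 0 <= w -> w ^+ 2 = k%:R / n%:R ->
  (ncycles g 1)%:R * (ncycles h 1)%:R <= K * n%:R ->
  (ncycles g 1)%:R ^+ 2 * (ncycles h 2)%:R <= K * n%:R ^+ 2 ->
  (ncycles g 1)%:R ^+ 3 <= s ^+ 3 * n%:R ^+ 2 ->
  s * k%:R < (ncycles g 1)%:R * w ->
  inv_set_mean g h k <= expR 1 * k%:R * expR (K / s + K / s ^+ 2 + 1 - k%:R / 4).
Proof.
move=> kn /andP[s0 s16] ks w0 w2 K1 K2 c3 big.
have [k0 lekn] := andP kn.
have n0 : 0 < n%:R :> R by rewrite ltr0n (leq_trans k0).
have kR : 1 <= k%:R :> R by rewrite ler1n.
have n1 : 1 <= n%:R :> R by rewrite ler1n (leq_trans k0).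
have kR0 : 0 < k%:R :> R by rewrite ltr0n.
set c := (ncycles g 1)%:R in K1 K2 c3 big *; set c' := (ncycles h 1)%:R in K1 *.
pose d : R := (ncycles g 2)%:R; set d' := (ncycles h 2)%:R in K2 *.
have d2 : 2 * d <= n%:R := ncycles2_le g.
have c0 : 0 < c.
  rewrite lt0r ler0n andbT; apply: contraTneq big => ->.
  by rewrite mul0r -leNgt mulr_ge0 ?ltW.
have ws : w <= s.
  rewrite -(@ler_pXn2r _ 2) // ?nnegrE ?(ltW s0) // w2 ler_pdivrMr //.
have cn : c <= s * n%:R.
  rewrite -(@ler_pXn2r _ 3) // ?nnegrE ?mulr_ge0 ?(ltW s0) ?(ltW c0) //.
  apply: le_trans c3 _; rewrite exprMn ler_pM2l ?exprn_gt0 //.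
  by rewrite ler_weXn2l.
(* [x] makes the fixed points of [g] cost exactly [s k]; [y] is then forced by [n x y = k]. *)
pose x := s * k%:R / c; pose y := c / (s * n%:R).
have x0 : 0 < x by rewrite divr_gt0 ?mulr_gt0.
have y0 : 0 < y by rewrite divr_gt0 ?mulr_gt0.
have xw : x <= w by rewrite ler_pdivrMr // [leRHS]mulrC ltW.
have y1 : y <= 1 by rewrite ler_pdivrMr ?mulr_gt0 // mul1r.
have x1 : x <= 1 by apply: (le_trans xw); lra.
have xy : n%:R * (x * y) = k%:R.
  by rewrite /x /y; field; rewrite !gt_eqF.
have s2 : s ^+ 2 <= 1 / 2 by rewrite expr2; nra.
have x01 : 0 < x <= 1 by rewrite x0.
have y01 : 0 < y <= 1 by rewrite y0.
apply: le_trans (inv_set_mean_le g h kn ks s2 x01 y01 xy) _.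
rewrite ler_pM2l ?mulr_gt0 ?expR_gt0 // ler_expR.
rewrite -/c -/c' -/d -/d'.
have nw2 : n%:R * w ^+ 2 = k%:R by rewrite w2 mulrCA divff ?mulr1 // gt_eqF.
have x2w : x ^+ 2 <= w ^+ 2 by apply: lerXn2r; rewrite ?nnegrE ?(ltW x0).
have e1 : c * x = s * k%:R by rewrite /x mulrCA divff ?mulr1 // gt_eqF.
(* At most [n / 2] transpositions fit, so they use only half of the available [k]; the terms in [s]
   leave more than [k / 4]. *)
have e2 : d * x ^+ 2 <= k%:R / 2.
  apply: le_trans (_ : (n%:R / 2) * w ^+ 2 <= _); last by rewrite -nw2; lra.
  by apply: ler_pM; rewrite ?exprn_ge0 ?(ltW x0) ?ler0n //; lra.
have e3 : n%:R * x ^+ 3 <= s * k%:R.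
  have nx2 : n%:R * x ^+ 2 <= k%:R by rewrite -[leRHS]nw2 ler_pM2l.
  rewrite exprSr mulrA [leRHS]mulrC; apply: ler_pM nx2 (le_trans xw ws); last exact: ltW.
  by rewrite mulr_ge0 ?exprn_ge0 ?(ltW x0) ?ler0n.
have e4 : c' * y <= K / s.
  rewrite /y mulrA ler_pdivrMr ?mulr_gt0 // mulrC [leRHS](_ : _ = K * n%:R) //.
  by field; rewrite gt_eqF.
have e5 : d' * y ^+ 2 <= K / s ^+ 2.
  rewrite /y expr_div_n mulrA ler_pdivrMr ?exprn_gt0 ?mulr_gt0 // mulrC.
  by rewrite [leRHS](_ : _ = K * n%:R ^+ 2) //; field; rewrite gt_eqF.
have e6 : n%:R * y ^+ 3 <= 1.
  rewrite /y expr_div_n mulrA ler_pdivrMr ?exprn_gt0 ?mulr_gt0 // mul1r.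
  by rewrite [leRHS](_ : _ = n%:R * (s ^+ 3 * n%:R ^+ 2)) ?ler_pM2l //; ring.
have e7 : s ^+ 2 * k%:R <= s * k%:R / 16.
  have sk : 0 <= s * k%:R by rewrite mulr_ge0 ?ltW.
  by rewrite expr2 -mulrA [leRHS]mulrC ler_wpM2r //; lra.
have e8 : s * k%:R <= k%:R / 16 by rewrite mulrC ler_pM2l; lra.
rewrite e1; lra.
Qed.

(** If fixed points are cheap at [w = sqrt (k / n)], take [x = y = w]: the transpositions cost at
    most [(1 - eps) k], and with [s = eps / 16] the other errors stay below [3 eps k / 4] in total.
    Otherwise the unbalanced choice applies to whichever permutation is expensive. *)
Lemma inv_set_mean_small n (g h : {perm 'I_n}) k (eps K : R) : (0 < k <= n)%N ->
  0 < eps <= 1 -> 0 <= K -> k%:R <= (eps / 16) ^+ 2 * n%:R ->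
  (ncycles g 2)%:R + (ncycles h 2)%:R <= (1 - eps) * n%:R ->
  (ncycles g 1)%:R * (ncycles h 1)%:R <= K * n%:R ->
  (ncycles g 1)%:R ^+ 2 * (ncycles h 2)%:R <= K * n%:R ^+ 2 ->
  (ncycles h 1)%:R ^+ 2 * (ncycles g 2)%:R <= K * n%:R ^+ 2 ->
  (ncycles g 1)%:R ^+ 3 <= (eps / 16) ^+ 3 * n%:R ^+ 2 ->
  (ncycles h 1)%:R ^+ 3 <= (eps / 16) ^+ 3 * n%:R ^+ 2 ->
  inv_set_mean g h k <= expR 1 * k%:R *
    expR (K / (eps / 16) + K / (eps / 16) ^+ 2 + 1 - eps / 4 * k%:R).
Proof.
move=> kn /andP[eps0 eps1] K0 ks ceps K1 K2 K2' c3 c3'.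
set s := eps / 16 in ks c3 c3' *.
have s0 : 0 < s by rewrite divr_gt0.
have s16 : 0 < s <= 1 / 16 by rewrite s0 /s; lra.
have [k0 lekn] := andP kn.
have n0 : 0 < n%:R :> R by rewrite ltr0n (leq_trans k0).
have kR0 : 0 < k%:R :> R by rewrite ltr0n.
pose w := Num.sqrt (k%:R / n%:R : R).
have w2 : w ^+ 2 = k%:R / n%:R by rewrite sqr_sqrtr // divr_ge0 ?ler0n.
have w0 : 0 < w by rewrite sqrtr_gt0 divr_gt0.
have mono : expR 1 * k%:R * expR (K / s + K / s ^+ 2 + 1 - k%:R / 4) <=
  expR 1 * k%:R * expR (K / s + K / s ^+ 2 + 1 - eps / 4 * k%:R).
  rewrite ler_pM2l ?mulr_gt0 ?expR_gt0 // ler_expR lerD2l lerN2 mulrAC.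
  by rewrite ler_pM2r ?invr_gt0 // ler_piMl // ltW.
have [le1|gt1] := leP ((ncycles g 1)%:R * w) (s * k%:R); last first.
  apply: le_trans mono.
  exact: (inv_set_mean_unbalanced kn s16 ks (ltW w0) w2 K1 K2 c3 gt1).
have [le1'|gt1'] := leP ((ncycles h 1)%:R * w) (s * k%:R); last first.
  apply: le_trans mono; rewrite inv_set_meanC.
  rewrite mulrC in K1.
  exact: (inv_set_mean_unbalanced kn s16 ks (ltW w0) w2 K1 K2' c3' gt1').
have ws : w <= s.
  by rewrite -(@ler_pXn2r _ 2) // ?nnegrE ?(ltW s0) ?(ltW w0) // w2 ler_pdivrMr.
have w01 : 0 < w <= 1 by rewrite w0 /=; case/andP: s16 => _; lra.
have nw2 : n%:R * w ^+ 2 = k%:R by rewrite w2 mulrCA divff ?mulr1 // gt_eqF.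
have s2 : s ^+ 2 <= 1 / 2 by case/andP: s16; rewrite expr2; nra.
have ww : n%:R * (w * w) = k%:R by rewrite -expr2.
apply: le_trans (inv_set_mean_le g h kn ks s2 w01 w01 ww) _.
rewrite ler_pM2l ?mulr_gt0 ?expR_gt0 // ler_expR.
have e3 : n%:R * w ^+ 3 <= s * k%:R.
  by rewrite exprSr mulrA nw2 mulrC ler_pM2r.
have e2 : (ncycles g 2)%:R * w ^+ 2 + (ncycles h 2)%:R * w ^+ 2 <= (1 - eps) * k%:R.
  by rewrite -mulrDl -[in leRHS]nw2 [leRHS]mulrA ler_wpM2r ?exprn_ge0 ?(ltW w0).
have e7 : s ^+ 2 * k%:R <= s * k%:R / 16.
  have sk : 0 <= s * k%:R by rewrite mulr_ge0 ?ltW.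
  by rewrite expr2 -mulrA [leRHS]mulrC ler_wpM2r //; case/andP: s16; lra.
have e9 : s * k%:R = eps * k%:R / 16 by rewrite /s; ring.
have e10 : 0 <= K / s by rewrite divr_ge0 ?(ltW s0).
have e11 : 0 <= K / s ^+ 2 by rewrite divr_ge0 ?exprn_ge0 ?(ltW s0).
have e12 : 0 <= eps * k%:R by rewrite mulr_ge0 ?(ltW eps0).
have e13 : (1 - eps) * k%:R = k%:R - eps * k%:R by ring.
rewrite e13 in e2.
lra.
Qed.

(** Up to a polynomial factor the binomial cancels the main term [(1 + z)^n / z^k]. The exponential
    gain comes from the points in cycles of length at least 3, of which [g] and [h] have at least
    [2 eps n] minus their fixed points. *)
Lemma inv_set_mean_large n (g h : {perm 'I_n}) k (b eps : R) : (0 < k)%N -> (2 * k <= n)%N ->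
  0 <= b -> 0 <= eps -> b * n%:R <= k%:R ->
  (ncycles g 2)%:R + (ncycles h 2)%:R <= (1 - eps) * n%:R ->
  inv_set_mean g h k <= expR 1 ^+ 2 * n%:R ^+ 2 *
    expR (3 / 2 * ((ncycles g 1)%:R + (ncycles h 1)%:R) - b * eps / 12 * n%:R).
Proof.
move=> k0 kn b0 eps0 bk ceps.
have kn' : (k < n)%N by lia.
have nk : 0 < (n - k)%:R :> R by rewrite ltr0n subn_gt0.
have kR : 0 < k%:R :> R by rewrite ltr0n.
have nR : 0 < n%:R :> R by rewrite ltr0n; lia.
have nkE : n%:R = k%:R + (n - k)%:R :> R by rewrite -natrD subnKC // ltnW.
(* The minimiser of [(1 + z)^n / z^k]; its square root serves as both [x] and [y]. *)
pose z : R := k%:R / (n - k)%:R.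
have z0 : 0 < z by rewrite divr_gt0.
have z1 : z <= 1 by rewrite ler_pdivrMr // mul1r ler_nat; lia.
have bz : b <= z.
  rewrite ler_pdivlMr //; apply: le_trans bk; rewrite ler_wpM2l // nkE.
  by rewrite lerDr ltW.
pose x := Num.sqrt z.
have x2 : x ^+ 2 = z by rewrite sqr_sqrtr // ltW.
have x0 : 0 < x by rewrite sqrtr_gt0.
have x1 : x <= 1 by rewrite -(@ler_pXn2r _ 2) // ?nnegrE ?(ltW x0) // x2 expr1n.
have x01 : 0 <= x <= 1 by rewrite ltW.
set c := (ncycles g 1)%:R; set c' := (ncycles h 1)%:R.
set d := (ncycles g 2)%:R in ceps *; set d' := (ncycles h 2)%:R in ceps *.
have gf : cycle_gf g x * cycle_gf h x <= (1 + z) ^+ n *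
    expR (3 / 2 * (c + c') - b * eps / 12 * n%:R).
  have p0 : 0 <= (1 + z) ^+ n by rewrite exprn_ge0 ?addr_ge0 ?ltW.
  rewrite -(@ler_pXn2r _ 2) // ?nnegrE ?mulr_ge0 ?cycle_gf_ge0 ?(ltW x0) ?expR_ge0 //.
  rewrite !exprMn.
  apply: le_trans (_ : ((1 + z) ^+ n * expR (2 * c - z / 12 * (n%:R - c - 2 * d))) *
    ((1 + z) ^+ n * expR (2 * c' - z / 12 * (n%:R - c' - 2 * d'))) <= _).
    by rewrite -x2; apply: ler_pM; rewrite ?exprn_ge0 ?cycle_gf_ge0 ?(ltW x0) ?cycle_gf_sqr_le.
  rewrite mulrACA -expr2 -expRD. apply: ler_wpM2l; first exact: exprn_ge0.
  rewrite -expRM_natl ler_expR.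
  have h1 : z * (c + c') <= c + c' by rewrite ler_piMl // addr_ge0 ?ler0n.
  have h2 : z * (eps * n%:R) <= z * (n%:R - (d + d')).
    by rewrite ler_wpM2l ?(ltW z0) //; lra.
  have h3 : b * (eps * n%:R) <= z * (eps * n%:R) by rewrite ler_wpM2r // mulr_ge0 // ltW.
  have h4 : 0 <= c + c' by rewrite addr_ge0 ?ler0n.
  nra.
have zk : 0 < z ^+ k by rewrite exprn_gt0.
have aa : (#|inv_sets g k| * #|inv_sets h k|)%:R <= cycle_gf g x * cycle_gf h x / z ^+ k :> R.
  rewrite ler_pdivlMr // -x2 expr2; exact: inv_sets_gf_le.
have C0 : 0 < 'C(n, k)%:R :> R by rewrite ltr0n bin_gt0 ltnW.
rewrite /inv_set_mean ler_pdivrMr //; apply: le_trans aa _.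
rewrite ler_pdivrMr //; apply: le_trans gf _.
set E := expR (_ - _).
have key : (1 + z) ^+ n <= 'C(n, k)%:R * (expR 1 ^+ 2 * n%:R ^+ 2) * z ^+ k.
  have := binomial_ge R (n := n) (k := k); rewrite k0 kn' => /(_ isT) bin.
  have -> : 1 + z = n%:R / (n - k)%:R by rewrite /z nkE; field; rewrite gt_eqF.
  rewrite expr_div_n ler_pdivrMr ?exprn_gt0 //; apply: le_trans bin _.
  have poly : k%:R ^+ k.+1 * (n - k)%:R ^+ (n - k).+1 <=
      n%:R ^+ 2 * (k%:R ^+ k * (n - k)%:R ^+ (n - k)) :> R.
    rewrite (exprSr _ k) (exprSr _ (n - k)) mulrACA [leRHS]mulrC.
    apply: ler_wpM2l; first by rewrite mulr_ge0 ?exprn_ge0 ?ler0n.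
    by rewrite [n%:R ^+ 2]expr2; apply: ler_pM => //; rewrite ler_nat ?leq_subr // ltnW.
  have zE : z ^+ k * (n - k)%:R ^+ n = k%:R ^+ k * (n - k)%:R ^+ (n - k).
    rewrite /z expr_div_n -{3}(subnKC (ltnW kn')) exprD; field.
    by rewrite expf_neq0 // gt_eqF.
  rewrite [leRHS](_ : _ = 'C(n, k)%:R * expR 1 ^+ 2 * (n%:R ^+ 2 * (z ^+ k * (n - k)%:R ^+ n)));
    last by rewrite !mulrA.
  rewrite zE [leLHS](_ : _ = 'C(n, k)%:R * expR 1 ^+ 2 * (k%:R ^+ k.+1 * (n - k)%:R ^+ (n - k).+1));
    last by rewrite !mulrA.
  by rewrite ler_pM2l // mulr_gt0 ?exprn_gt0 ?expR_gt0.
apply: le_trans (_ : 'C(n, k)%:R * (expR 1 ^+ 2 * n%:R ^+ 2) * z ^+ k * E <= _).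
  by rewrite ler_wpM2r ?expR_ge0.
by rewrite [leRHS](_ : _ = 'C(n, k)%:R * (expR 1 ^+ 2 * n%:R ^+ 2) * z ^+ k * E) //; ring.
Qed.
End InvariantSetBounds.

(** * Large orbits *)

Section Eventually.
(** Convergence along [\oo] with an explicit threshold. *)
Definition ev (P : nat -> Prop) := exists N, forall n, (N <= n)%N -> P n.

Lemma ev_and P Q : ev P -> ev Q -> ev (fun n => P n /\ Q n).
Proof.
move=> [N HN] [N' HN']; exists (maxn N N') => n; rewrite geq_max => /andP[? ?].
by split; [apply: HN | apply: HN'].
Qed.

Lemma ev_mono (P Q : nat -> Prop) : (forall n, P n -> Q n) -> ev P -> ev Q.
Proof. by move=> PQ [N HN]; exists N => n /HN/PQ. Qed.

Lemma ev_ge N : ev (fun n => (N <= n)%N).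
Proof. by exists N. Qed.

Lemma ev_natr_ge (R : realType) (x : R) : ev (fun n => (x <= n%:R)%R).
Proof.
exists (Num.bound `|x|%R) => n; rewrite -(ler_nat R); apply: le_trans.
by apply: le_trans (ler_norm x) _; apply/ltW/archi_boundP.
Qed.
End Eventually.

Section Tail.
Local Open Scope ring_scope.
Variable R : realType.

Lemma expRN_le_inv (x : R) : 0 < x -> expR (- x) <= x^-1.
Proof.
move=> x0; rewrite expRN lef_pV2 ?posrE ?expR_gt0 //.
by apply: le_trans (expR_ge1Dx x); rewrite lerDr.
Qed.

Lemma geometric_tail_le (q : R) M n : 0 <= q <= 1 ->
  (\sum_(k < n | (M < k)%N) q ^+ k) * (1 - q) <= q ^+ M.
Proof.
case/andP=> q0 q1.
(* The remainder term makes the induction telescope; the maximum keeps it constant while the sum is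
   still empty. *)
suff : (\sum_(k < n | (M < k)%N) q ^+ k) * (1 - q) + q ^+ maxn n M.+1 <= q ^+ M.+1.
  have : q ^+ M.+1 <= q ^+ M by rewrite ler_wiXn2l.
  have : 0 <= q ^+ maxn n M.+1 by rewrite exprn_ge0.
  lra.
elim: n => [|n IH]; first by rewrite big_ord0 mul0r add0r max0n.
rewrite big_mkcond big_ord_recr -big_mkcond /=.
have [Mn|nM] := ltnP M n; last first.
  have -> : maxn n.+1 M.+1 = M.+1 by lia.
  have mE : maxn n M.+1 = M.+1 by lia.
  by rewrite mE in IH; rewrite addr0.
have -> : maxn n.+1 M.+1 = n.+1 by lia.
have nE : maxn n M.+1 = n by lia.
rewrite nE in IH.
by apply: le_trans IH; rewrite exprS; lra.
Qed.

(** The term [x^4 / 24] of the exponential series beats the cubic prefactor. *)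
Lemma ev_poly_exp (C c e : R) : 0 < c -> 0 < e -> 0 <= C ->
  ev (fun n => n.+1%:R * (C * n%:R ^+ 2 * expR (- (c * n%:R))) <= e).
Proof.
move=> c0 e0 C0.
apply: ev_mono (ev_and (ev_ge 1) (ev_natr_ge (48 * C / (c ^+ 4 * e)))) => n [n1 nbig].
have n0 : 0 < n%:R :> R by rewrite ltr0n.
have cn0 : 0 < c * n%:R by rewrite mulr_gt0.
have E : expR (- (c * n%:R)) <= 24 / (c * n%:R) ^+ 4.
  rewrite expRN -invf_div lef_pV2 ?posrE ?expR_gt0 ?divr_gt0 ?exprn_gt0 //.
  by apply: le_trans (expR_ge1Dxn 3 (ltW cn0)); rewrite lerDr.
apply: le_trans (_ : (2 * n%:R) * (C * n%:R ^+ 2 * (24 / (c * n%:R) ^+ 4)) <= _).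
  apply: ler_pM; rewrite ?mulr_ge0 ?exprn_ge0 ?expR_ge0 ?ler0n //.
    by rewrite -natrM ler_nat; lia.
  by apply: ler_wpM2l E; rewrite mulr_ge0 ?exprn_ge0 ?ler0n.
have -> : (2 * n%:R) * (C * n%:R ^+ 2 * (24 / (c * n%:R) ^+ 4)) = 48 * C / (c ^+ 4 * n%:R).
  by field; rewrite !gt_eqF.
move: nbig; rewrite !ler_pdivrMr ?mulr_gt0 ?exprn_gt0 // => nbig.
by apply: le_trans nbig _; rewrite [leLHS](_ : _ = e * (c ^+ 4 * n%:R)) //; ring.
Qed.

Variables (g h : forall n, {perm 'I_n}) (K eps : R).
Hypothesis eps01 : 0 < eps <= 1.
Hypothesis K0 : 0 <= K.
Hypothesis fixed_small : forall d : R, 0 < d ->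
  ev (fun n => (ncycles (g n) 1 + ncycles (h n) 1)%:R ^+ 3 <= d * n%:R ^+ 2).
Hypothesis products_bounded : ev (fun n =>
  [/\ (ncycles (g n) 1)%:R * (ncycles (h n) 1)%:R <= K * n%:R,
      (ncycles (g n) 1)%:R ^+ 2 * (ncycles (h n) 2)%:R <= K * n%:R ^+ 2 &
      (ncycles (h n) 1)%:R ^+ 2 * (ncycles (g n) 2)%:R <= K * n%:R ^+ 2]).
Hypothesis transpositions_bounded : forall n,
  (ncycles (g n) 2)%:R + (ncycles (h n) 2)%:R <= (1 - eps) * n%:R.

Lemma ev_fixed_le (s : R) : 0 < s ->
  ev (fun n => (ncycles (g n) 1 + ncycles (h n) 1)%:R <= s * n%:R).
Proof.
move=> s0; apply: ev_mono (ev_and (ev_ge 1) (fixed_small (exprn_gt0 3 s0))) => n [n1 le3].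
have n1R : 1 <= n%:R :> R by rewrite ler1n.
rewrite -(@ler_pXn2r _ 3) // ?nnegrE ?mulr_ge0 ?(ltW s0) ?ler0n //.
apply: le_trans le3 _; rewrite exprMn ler_pM2l ?exprn_gt0 //.
by rewrite ler_weXn2l.
Qed.

(** Sizes up to [s^2 n] give a geometric series, small once [M] is large; each larger size
    contributes at most [D n], and [n + 1] such terms still tend to 0. *)
Lemma inv_set_mean_tail (e : R) : 0 < e -> exists M, ev (fun n =>
  \sum_(k < n.+1 | (M < k)%N && (k * 2 <= n)%N) inv_set_mean R (g n) (h n) k <= e).
Proof.
move=> e0; have [eps0 eps1] := andP eps01.
set s := eps / 16; have s0 : 0 < s by rewrite divr_gt0.
(* Half of the decay rate [eps / 4] is spent on absorbing the factor [k]. *)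
have [q qE] : exists q : R, q = expR (- (eps / 8)) by eexists.
have q0 : 0 < q by rewrite qE expR_gt0.
have q1 : q < 1 by rewrite qE -expR0 ltr_expR oppr_lt0 divr_gt0.
have [C C0 CE] : exists2 C, 0 < C & C = expR 1 * (8 / eps) * expR (K / s + K / s ^+ 2 + 1).
  by eexists; last reflexivity; rewrite !mulr_gt0 ?invr_gt0 ?expR_gt0.
pose D n : R := expR 1 ^+ 2 * n%:R ^+ 2 * expR (- (s ^+ 2 * eps / 24 * n%:R)).
have D0 n : 0 <= D n by rewrite /D !mulr_ge0 ?exprn_ge0 ?expR_ge0 ?ler0n.
have [M HM] : exists M : nat, C * (q ^+ M / (1 - q)) <= e / 2.
  (* Solves for [M] after bounding [q ^+ M] by [8 / (M eps)]; the added 1 makes [M] positive. *)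
  have [M HM] := ev_natr_ge (16 * C / (eps * e * (1 - q)) + 1).
  exists M; have {}HM := HM M (leqnn _).
  have q1' : 0 < 1 - q by rewrite subr_gt0.
  have M0 : 0 < M%:R :> R.
    have : 0 < 16 * C / (eps * e * (1 - q)).
      by apply: divr_gt0; rewrite !mulr_gt0.
    by move: HM; lra.
  have qM : q ^+ M <= (M%:R * (eps / 8))^-1.
    by rewrite qE -expRM_natl mulrN expRN_le_inv // mulr_gt0 ?divr_gt0.
  have {}HM : 16 * C / (eps * e * (1 - q)) <= M%:R by apply: le_trans HM; rewrite lerDl.
  apply: le_trans (_ : C * ((M%:R * (eps / 8))^-1 / (1 - q)) <= _).
    by rewrite ler_pM2l // ler_pM2r ?invr_gt0.
  move: HM; rewrite ler_pdivrMr ?mulr_gt0 // => HM.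
  have -> : C * ((M%:R * (eps / 8))^-1 / (1 - q)) = (16 * C) / (M%:R * eps * (1 - q)) / 2.
    by field; rewrite !gt_eqF.
  rewrite ler_pM2r ?invr_gt0 // ler_pdivrMr ?mulr_gt0 //.
  by apply: le_trans HM _; rewrite [leLHS](_ : _ = e * (M%:R * eps * (1 - q))) //; ring.
exists M.
have e2 : 0 < e / 2 by rewrite divr_gt0.
have c0 : 0 < s ^+ 2 * eps / 24 by rewrite divr_gt0 ?mulr_gt0 ?exprn_gt0.
have E0 : 0 <= expR 1 ^+ 2 :> R by rewrite exprn_ge0 ?expR_ge0.
(* The factor [3 / 2] turns this fixed-point bound into [s^2 eps / 24], half of the decay rate
   [s^2 eps / 12]. *)
have t0 : 0 < s ^+ 2 * eps / 36 by rewrite divr_gt0 ?mulr_gt0 ?exprn_gt0.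
have evs := ev_and (ev_poly_exp c0 e2 E0) (ev_and (ev_fixed_le t0)
  (ev_and (fixed_small (exprn_gt0 3 s0)) products_bounded)).
apply: ev_mono evs => n [polyE [fixn [fix3 [P1 P2 P3]]]].
have term k : (0 < k)%N -> (k * 2 <= n)%N -> inv_set_mean R (g n) (h n) k <= C * q ^+ k + D n.
  move=> k0 kn; have [ks|sk] := leP k%:R (s ^+ 2 * n%:R).
    apply: le_trans (_ : C * q ^+ k <= _); last by rewrite lerDl.
    have kn' : (0 < k <= n)%N by rewrite k0; apply: leq_trans kn; rewrite leq_pmulr.
    have c3 : (ncycles (g n) 1)%:R ^+ 3 <= s ^+ 3 * n%:R ^+ 2.
      by apply: (le_trans _ fix3); apply: lerXn2r; rewrite ?nnegrE ?ler0n // ler_nat leq_addr.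
    have c3' : (ncycles (h n) 1)%:R ^+ 3 <= s ^+ 3 * n%:R ^+ 2.
      by apply: (le_trans _ fix3); apply: lerXn2r; rewrite ?nnegrE ?ler0n // ler_nat leq_addl.
    apply: le_trans (inv_set_mean_small kn' eps01 K0 ks (transpositions_bounded n) P1 P2 P3 c3 c3') _.
    rewrite -/s expRD.
    have kE : k%:R <= 8 / eps * expR (eps / 8 * k%:R).
      rewrite -ler_pdivrMl ?divr_gt0 // invf_div; apply: le_trans (expR_ge1Dx _).
      by rewrite lerDr.
    have -> : q ^+ k = expR (eps / 8 * k%:R) * expR (- (eps / 4 * k%:R)).
      by rewrite qE -expRM_natl -expRD; congr expR; field.
    rewrite CE; set X := expR (_ + 1); set Z := expR (- (eps / 4 * _)).
    rewrite [leLHS](_ : _ = expR 1 * X * Z * k%:R); last by ring.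
    rewrite [leRHS](_ : _ = expR 1 * X * Z * (8 / eps * expR (eps / 8 * k%:R))); last by ring.
    by rewrite ler_pM2l // !mulr_gt0 ?expR_gt0.
  apply: le_trans (_ : D n <= _); last by rewrite lerDr mulr_ge0 ?exprn_ge0 ?ltW.
  have kn2 : (2 * k <= n)%N by rewrite mulnC.
  apply: le_trans (inv_set_mean_large k0 kn2 (exprn_ge0 2 (ltW s0)) (ltW eps0) (ltW sk) (transpositions_bounded n)) _.
  rewrite /D ler_wpM2l ?mulr_ge0 ?exprn_ge0 ?ler0n //.
  by rewrite ler_expR; move: fixn; rewrite natrD; lra.
apply: le_trans (_ : \sum_(k < n.+1 | (M < k)%N) (C * q ^+ k) + \sum_(k < n.+1) D n <= _).
  rewrite big_mkcond [X in _ <= X + _]big_mkcond -big_split; apply: ler_sum => k _ /=.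
  case: ifP => [/andP[Mk kn]|_]; first by rewrite Mk term // (leq_ltn_trans _ Mk).
  by case: ifP => _; rewrite ?addr_ge0 // mulr_ge0 ?exprn_ge0 ?ltW.
rewrite (splitr e); apply: lerD; last first.
  by rewrite sumr_const card_ord -[_ *+ _]mulr_natl; exact: polyE.
rewrite -mulr_sumr; apply: le_trans HM; rewrite ler_pM2l //.
rewrite ler_pdivlMr ?subr_gt0 // geometric_tail_le //.
by rewrite !ltW.
Qed.
End Tail.

(** * Factorial moments of the number of small orbits *)

Section NullSequences.
Local Open Scope ring_scope.
Variable R : realType.
Implicit Types u v : nat -> R.

Definition null u := forall e : R, 0 < e -> ev (fun n => `|u n| <= e).
Definition bdd u := exists C : R, ev (fun n => `|u n| <= C).

Lemma null_dom u v : ev (fun n => `|u n| <= `|v n|) -> null v -> null u.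
Proof.
move=> uv v0 e e0; apply: ev_mono (ev_and uv (v0 e e0)) => n [? ?]; exact: le_trans (_ : `|v n| <= e).
Qed.

Lemma null_eq u v : ev (fun n => u n = v n) -> null v -> null u.
Proof. by move=> uv; apply: null_dom; apply: ev_mono uv => n ->. Qed.

Lemma null_bdd u : null u -> bdd u.
Proof. by move=> /(_ 1 ltr01) ?; exists 1. Qed.

Lemma bdd_dom u v : ev (fun n => `|u n| <= `|v n|) -> bdd v -> bdd u.
Proof.
move=> uv [C vC]; exists C; apply: ev_mono (ev_and uv vC) => n [? ?].
exact: le_trans (_ : `|v n| <= C).
Qed.

Lemma bdd_cst (x : R) : bdd (fun=> x).
Proof. by exists `|x|; exists 0%N. Qed.

Lemma null0 : null (fun=> 0).
Proof. by move=> e e0; exists 0%N => n _; rewrite normr0 ltW. Qed.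

Lemma nullD u v : null u -> null v -> null (fun n => u n + v n).
Proof.
move=> u0 v0 e e0; have e2 : 0 < e / 2 by rewrite divr_gt0.
apply: ev_mono (ev_and (u0 _ e2) (v0 _ e2)) => n [? ?].
by rewrite (splitr e); apply: le_trans (ler_normD _ _) (lerD _ _).
Qed.

Lemma bddD u v : bdd u -> bdd v -> bdd (fun n => u n + v n).
Proof.
move=> [C uC] [D vD]; exists (C + D); apply: ev_mono (ev_and uC vD) => n [? ?].
by apply: le_trans (ler_normD _ _) (lerD _ _).
Qed.

Lemma bddM u v : bdd u -> bdd v -> bdd (fun n => u n * v n).
Proof.
move=> [C uC] [D vD]; exists (C * D); apply: ev_mono (ev_and uC vD) => n [? ?].
by rewrite normrM ler_pM.
Qed.

Lemma bddX u m : bdd u -> bdd (fun n => u n ^+ m).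
Proof.
move=> bu; elim: m => [|m IH]; first exact: (bdd_cst 1).
by apply: bdd_dom (bddM bu IH); exists 0%N => n _; rewrite exprS.
Qed.

Lemma nullM u v : bdd u -> null v -> null (fun n => u n * v n).
Proof.
move=> [C uC] v0 e e0; have C1 : 0 < `|C| + 1 by rewrite ltr_wpDl.
apply: ev_mono (ev_and uC (v0 (e / (`|C| + 1)) (divr_gt0 e0 C1))) => n [hu hv].
rewrite normrM; apply: le_trans (_ : (`|C| + 1) * (e / (`|C| + 1)) <= _); last first.
  by rewrite mulrCA divff ?mulr1 // gt_eqF.
apply: ler_pM => //; apply: le_trans hu _; apply: le_trans (ler_norm C) _.
by rewrite lerDl.
Qed.

Lemma nullN u : null u -> null (fun n => - u n).
Proof. by apply: null_dom; exists 0%N => n _; rewrite normrN. Qed.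

Lemma null_sum (I : Type) (s : seq I) (P : pred I) (F : I -> nat -> R) :
  (forall i, P i -> null (F i)) -> null (fun n => \sum_(i <- s | P i) F i n).
Proof.
move=> F0; elim: s => [|i s IH]; first by apply: null_eq null0; exists 0%N => n _; rewrite big_nil.
case Pi : (P i); last by apply: null_eq IH; exists 0%N => n _; rewrite big_cons Pi.
by apply: null_eq (nullD (F0 i Pi) IH); exists 0%N => n _; rewrite big_cons Pi.
Qed.

Lemma bdd_sum (I : Type) (s : seq I) (P : pred I) (F : I -> nat -> R) :
  (forall i, P i -> bdd (F i)) -> bdd (fun n => \sum_(i <- s | P i) F i n).
Proof.
move=> F0; elim: s => [|i s IH].
  by apply: bdd_dom (bdd_cst 0); exists 0%N => n _; rewrite big_nil.
case Pi : (P i); last by apply: bdd_dom IH; exists 0%N => n _; rewrite big_cons Pi.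
by apply: bdd_dom (bddD (F0 i Pi) IH); exists 0%N => n _; rewrite big_cons Pi.
Qed.

Lemma null_inv : null (fun n => n%:R^-1).
Proof.
move=> e e0; apply: ev_mono (ev_and (ev_ge 1) (ev_natr_ge e^-1)) => n [n1 ne].
have n0 : 0 < n%:R :> R by rewrite ltr0n.
by rewrite ger0_norm ?invr_ge0 ?ler0n // -[leRHS]invrK lef_pV2 // posrE invr_gt0.
Qed.

(** For [m <= n], the ratio of [n^m] to the falling factorial. *)
Definition ffact_ratio m n : R := n%:R ^+ m * (n - m)`!%:R / n`!%:R.

Lemma null_ffact_ratio m : null (fun n => ffact_ratio m n - 1).
Proof.
elim: m => [|m IH].
  apply: null_eq null0; exists 0%N => n _; rewrite /ffact_ratio expr0 mul1r subn0.
  by rewrite divff ?subrr // pnatr_eq0 -lt0n fact_gt0.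
(* Passing from [m] to [m.+1] multiplies the ratio by [n / (n - m) = 1 + m / (n - m)]. *)
have e1 : ev (fun n => ffact_ratio m.+1 n - 1 =
    (ffact_ratio m n - 1) + ffact_ratio m n * (m%:R / (n - m)%:R)).
  apply: ev_mono (ev_ge m.+1) => n mn.
  have nm : (n - m)%:R != 0 :> R by rewrite pnatr_eq0 -lt0n subn_gt0.
  have nf : n`!%:R != 0 :> R by rewrite pnatr_eq0 -lt0n fact_gt0.
  have nE : n%:R = (n - m)%:R + m%:R :> R by rewrite -natrD subnK // ltnW.
  rewrite /ffact_ratio subnS; have -> : (n - m)`! = ((n - m) * (n - m).-1`!)%N.
    by rewrite -{1}(prednK (_ : 0 < n - m)%N) ?subn_gt0 // factS prednK ?subn_gt0.
  by rewrite natrM exprS {1}nE; field; rewrite nm nf.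
apply: null_eq e1 _; apply: nullD => //; apply: nullM.
  by apply: bdd_dom (bddD (null_bdd IH) (bdd_cst 1)); exists 0%N => n _; rewrite subrK.
apply: nullM (bdd_cst _) _.
move=> e e0; have [N HN] := null_inv e0; exists (N + m)%N => n Nn; apply: HN.
by rewrite leq_subRL ?(leq_trans _ Nn) ?leq_addl // addnC.
Qed.

Lemma bdd_ffact_ratio m : bdd (ffact_ratio m).
Proof.
apply: bdd_dom (bddD (null_bdd (null_ffact_ratio m)) (bdd_cst 1)).
by exists 0%N => n _; rewrite subrK.
Qed.
End NullSequences.

Lemma atomC (T : finType) (p q : {perm T}) A : atom p q A = atom q p A.
Proof.
have sC B : stable2 p q B = stable2 q p B.
  by apply: eq_forallb => x; rewrite [X in _ ==> X]andbC.
rewrite /atom sC; congr [&& _, _ & _].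
by apply: eq_forallb => B; rewrite sC.
Qed.

(** * Asymptotic independence of disjoint pieces *)

Section Decorrelation.
Variables (k : nat) (s1 t1 : {perm 'I_k}) (Y : finType) (s2 t2 : {perm Y}).
Variables (T : finType) (g h : {perm T}) (A K : nat).
Hypothesis tr : atom s1 t1 [set: 'I_k].
Hypothesis gA : maxn 1 (cycle_points g 1) <= A.
Hypothesis hA : maxn 1 (cycle_points h 1) <= A.
Hypothesis A_le : A <= #|T|.

(** Telescoping: the two counts for the union are replaced by products one after the other. Each
    replacement costs the colliding pairs, where a prescribed value removes a whole cycle, so
    [prod_cycle_points_remove] applies. *)
Lemma Einj_sum_defect :
  #|T| * (#|Einj s1 g| * #|Einj t1 h| * (#|Einj s2 g| * #|Einj t2 h|)) <=
  #|T| * (#|Einj (sum_perm s1 s2) g| * #|Einj (sum_perm t1 t2) h|) +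
  2 * k * #|Y| * (#|Einj s2 g| * #|Einj t2 h|) * (A * #|T| ^ k).
Proof.
set n := #|T|.
pose V x := \prod_(O in porbits s1 :\ porbit s1 x) cycle_points g #|O|.
pose W x := \prod_(O in porbits t1 :\ porbit t1 x) cycle_points h #|O|.
have ge1 := @card_Einj_sum_ge _ _ _ s1 s2 g V (card_Einj_at_le s1 g).
have ge2 := @card_Einj_sum_ge _ _ _ t1 t2 h W (card_Einj_at_le t1 h).
have le1 := card_Einj_sum_le s1 s2 g.
have kE : k * (A * n ^ k) = \sum_(x < k) A * n ^ k by rewrite sum_nat_const card_ord.
have tr' : atom t1 s1 [set: 'I_k] by rewrite atomC.
have hV : n * ((\sum_x V x) * #|Einj t1 h|) <= k * (A * n ^ k).
  rewrite kE big_distrl big_distrr; apply: leq_sum => x _.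
  apply: leq_trans (prod_cycle_points_remove tr x gA hA A_le).
  by rewrite leq_mul2l leq_mul ?orbT // card_Einj_le.
have hW : n * (#|Einj s1 g| * \sum_x W x) <= k * (A * n ^ k).
  rewrite kE !big_distrr; apply: leq_sum => x _.
  apply: leq_trans (prod_cycle_points_remove tr' x hA gA A_le).
  by rewrite leq_mul2l mulnC leq_mul ?orbT // card_Einj_le.
move: hV hW ge1 ge2 le1.
move: (\sum_x V x) (\sum_x W x) #|Einj (sum_perm s1 s2) g| #|Einj (sum_perm t1 t2) h|.
move: #|Einj s1 g| #|Einj t1 h| #|Einj s2 g| #|Einj t2 h| #|Y| (A * n ^ k) => I1 J1 I2 J2 y P SV SW I J.
move=> hV hW ge1 ge2 le1.
have a1 := leq_mul (leqnn (n * (J1 * J2))) ge1.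
have a2 := leq_mul (leqnn (n * I)) ge2.
have a3 : n * I * (y * J2 * SW) <= (y * I2 * J2) * (n * (I1 * SW)).
  rewrite (_ : (y * I2 * J2) * (n * (I1 * SW)) = n * (I1 * I2) * (y * J2 * SW)); last by lia.
  by rewrite leq_mul2r leq_mul2l le1 !orbT.
have a4 := leq_mul (leqnn (y * I2 * J2)) hV.
have a5 := leq_mul (leqnn (y * I2 * J2)) hW.
nia.
Qed.
End Decorrelation.

(** * Convergence of the factorial moments *)

Section Moments.
Local Open Scope ring_scope.
Variable R : realType.
Variables (g h : forall n, {perm 'I_n}) (K : R).
Hypothesis K0 : 0 <= K.
Hypothesis fixed_small : forall d : R, 0 < d ->
  ev (fun n => (ncycles (g n) 1 + ncycles (h n) 1)%:R ^+ 3 <= d * n%:R ^+ 2).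
Hypothesis products_bounded : ev (fun n =>
  [/\ (ncycles (g n) 1)%:R * (ncycles (h n) 1)%:R <= K * n%:R,
      (ncycles (g n) 1)%:R ^+ 2 * (ncycles (h n) 2)%:R <= K * n%:R ^+ 2 &
      (ncycles (h n) 1)%:R ^+ 2 * (ncycles (g n) 2)%:R <= K * n%:R ^+ 2]).

Let fixed n := maxn 1 (ncycles (g n) 1 + ncycles (h n) 1).

Lemma cycle_points1 n (u : {perm 'I_n}) : cycle_points u 1 = ncycles u 1.
Proof. by rewrite cycle_pointsE mul1n. Qed.

Lemma cycle_points2 n (u : {perm 'I_n}) : cycle_points u 2 = (2 * ncycles u 2)%N.
Proof. exact: cycle_pointsE. Qed.

Lemma null_fixed : null (fun n => (fixed n)%:R / n%:R : R).
Proof.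
move=> e e0; apply: ev_mono (ev_and (ev_fixed_le fixed_small e0) (ev_and (ev_ge 1) (ev_natr_ge e^-1))).
move=> n [le [n1 ne]]; have n0 : 0 < n%:R :> R by rewrite ltr0n.
rewrite ger0_norm ?divr_ge0 ?ler0n // ler_pdivrMr // /fixed.
rewrite natr_max ge_max le andbT.
by rewrite -ler_pdivrMl // mulr1.
Qed.

Lemma ev_bounds : exists2 C : nat, (0 < C)%N & ev (fun n =>
  let a := maxn 1 (cycle_points (g n) 1) in let a' := maxn 1 (cycle_points (h n) 1) in
  [/\ (0 < n)%N, (a <= fixed n)%N, (a' <= fixed n)%N, (fixed n <= n)%N &
   [/\ (fixed n ^ 3 <= n ^ 2)%N, (a * a' <= C * n)%N,
      (a ^ 2 * cycle_points (h n) 2 <= C * n ^ 2)%N &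
      (a' ^ 2 * cycle_points (g n) 2 <= C * n ^ 2)%N]]).
Proof.
(* [2 K] because [cycle_points] counts both points of a transposition; the extra 2 pays for
   replacing fixed-point counts by their maximum with 1. *)
exists (Num.bound (2 * K + 2)).
  by rewrite -(ltr0n R); apply: le_lt_trans (archi_boundP _); rewrite ?addr_ge0 ?mulr_ge0.
have CE : 2 * K + 2 <= (Num.bound (2 * K + 2))%:R by apply/ltW/archi_boundP; rewrite ?addr_ge0 ?mulr_ge0.
move: (Num.bound _) CE => C CE.
apply: ev_mono (ev_and (ev_and (ev_fixed_le fixed_small ltr01) (fixed_small ltr01))
  (ev_and products_bounded (ev_ge 1))) => n [[f1 f3] [[P1 P2 P3] n1]] /=.
rewrite !cycle_points1 !cycle_points2.
have b2 := ncycles2_le R (g n); have b2' := ncycles2_le R (h n).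
move: f1 f3 P1 P2 P3 b2 b2'; rewrite !mul1r /fixed.
move: (ncycles (g n) 1) (ncycles (h n) 1) (ncycles (g n) 2) (ncycles (h n) 2) => c c' d d'.
move=> f1 f3 P1 P2 P3 b2 b2'.
have n0 : 0 < n%:R :> R by rewrite ltr0n.
have n1R : 1 <= n%:R :> R by rewrite ler1n.
have f1' : (c + c' <= n)%N by rewrite -(ler_nat R).
have f3' : ((c + c') ^ 3 <= n ^ 2)%N by rewrite -(ler_nat R) !natrX.
have sq (x y : nat) : 2 * y%:R <= n%:R :> R -> x%:R ^+ 2 * y%:R <= K * n%:R ^+ 2 ->
    (maxn 1 x ^ 2 * (2 * y) <= C * n ^ 2)%N.
  move=> yn xy; rewrite -(ler_nat R) (natrM _ (maxn 1 x ^ 2)) (natrM _ C) !natrX natrM.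
  apply: le_trans (_ : (1 + x%:R ^+ 2) * (2 * y%:R) <= _).
    rewrite ler_wpM2r ?mulr_ge0 ?ler0n // -!natrX -(natrD _ 1) ler_nat.
    by case: x {xy} => [|x]; rewrite ?max0n ?maxn0 // (maxn_idPr _) // leq_addl.
  have : n%:R <= n%:R ^+ 2 :> R by rewrite expr2 ler_peMl // ltW.
  have : (2 * K + 2) * n%:R ^+ 2 <= C%:R * n%:R ^+ 2 by rewrite ler_wpM2r ?sqr_ge0.
  have : 0 <= n%:R ^+ 2 :> R by exact: sqr_ge0.
  move: (n%:R ^+ 2) (x%:R ^+ 2) xy yn => N2 X xy yn.
  have -> : (1 + X) * (2 * y%:R) = 2 * y%:R + 2 * (X * y%:R) by ring.
  lra.
split => //.
- by rewrite geq_max leq_maxl (leq_trans (leq_addr _ _) (leq_maxr _ _)).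
- by rewrite geq_max leq_maxl (leq_trans (leq_addl _ _) (leq_maxr _ _)).
- by rewrite geq_max n1.
split; [| | exact: sq | exact: sq].
  rewrite /maxn; case: ifP => _ //; by rewrite exp1n expn_gt0 n1.
rewrite -(ler_nat R) !natrM.
apply: le_trans (_ : (1 + c%:R) * (1 + c'%:R) <= _).
  by apply: ler_pM; rewrite ?ler0n // -(natrD _ 1) ler_nat geq_max leq_addr leq_addl.
have : (c + c')%:R <= n%:R :> R by [].
have : (2 * K + 2) * n%:R <= C%:R * n%:R by rewrite ler_wpM2r.
have : 0 <= K * n%:R by exact: mulr_ge0.
rewrite natrD; lra.
Qed.

(* By class_mean this is also the average over the two conjugacy classes. *)
Definition mean n (F : {perm 'I_n} -> {perm 'I_n} -> R) : R :=
  (\sum_(v : {perm 'I_n}) F (g n) (h n ^ v)%g) / n`!%:R.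

Definition emb (Y : finType) (s t : {perm Y}) n (p q : {perm 'I_n}) : R :=
  #|Einj s p :&: Einj t q|%:R.

(** Normalised so that the mean of [emb] is this quantity times a factor tending to 1. *)
Definition emb_density (Y : finType) (s t : {perm Y}) n : R :=
  (#|Einj s (g n)| * #|Einj t (h n)|)%:R / n%:R ^+ #|Y|.

Lemma mean_emb (Y : finType) (s t : {perm Y}) n : (0 < n)%N ->
  mean (@emb Y s t n) = emb_density s t n * ffact_ratio R #|Y| n.
Proof.
move=> n0; rewrite /mean /emb -natr_sum sum_card_Einj card_ord !natrM.
have nn : n%:R ^+ #|Y| != 0 :> R by rewrite expf_neq0 // pnatr_eq0 -lt0n.
have nf : n`!%:R != 0 :> R by rewrite pnatr_eq0 -lt0n fact_gt0.
by rewrite /emb_density /ffact_ratio natrM; field; rewrite nn nf.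
Qed.

Definition tame (Y : finType) (s t : {perm Y}) := bdd (emb_density s t).

Lemma emb_density_ge0 (Y : finType) (s t : {perm Y}) n : 0 <= emb_density s t n.
Proof. by rewrite divr_ge0 ?exprn_ge0 ?ler0n. Qed.

Lemma tame_bdd_mean (Y : finType) (s t : {perm Y}) :
  tame s t -> bdd (fun n => mean (@emb Y s t n)).
Proof.
move=> ts; apply: bdd_dom (bddM ts (@bdd_ffact_ratio R #|Y|)).
by apply: ev_mono (ev_ge 1) => n n1; rewrite mean_emb.
Qed.

Lemma tame_transitive k (s t : {perm 'I_k}) : atom s t [set: 'I_k] -> tame s t.
Proof.
move=> tr; have [C C0 evC] := ev_bounds; exists C%:R.
apply: ev_mono evC => n /= [n0 a1 a2 a3 [a4 a5 a6 a7]].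
rewrite ger0_norm ?emb_density_ge0 //.
rewrite /emb_density card_ord ler_pdivrMr ?exprn_gt0 ?ltr0n // -natrX -natrM ler_nat.
have bd := @prod_cycle_points_transitive k s t _ (g n) (h n) tr (fixed n) C.
rewrite card_ord in bd.
apply: leq_trans (bd n0 C0 a1 a2 a4 a5 a6 a7).
by rewrite leq_mul // card_Einj_le.
Qed.

(** After division by [n^(k + #|Y| + 1)] the defect is a bounded density times [fixed n / n], which
    tends to 0. *)
Lemma null_decorrelation k (s1 t1 : {perm 'I_k}) (Y : finType) (s2 t2 : {perm Y}) :
  atom s1 t1 [set: 'I_k] -> tame s2 t2 ->
  null (fun n => emb_density (sum_perm s1 s2) (sum_perm t1 t2) n -
                 emb_density s1 t1 n * emb_density s2 t2 n).
Proof.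
move=> tr t2P; have [C C0 evC] := ev_bounds.
apply: null_dom (nullM (bddM (bdd_cst (2 * k * #|Y|)%:R) t2P) null_fixed).
apply: ev_mono evC => n /= [n0 a1 a2 a3 _].
have := @Einj_sum_defect k s1 t1 Y s2 t2 _ (g n) (h n) (fixed n) tr a1 a2.
rewrite card_ord => /(_ a3).
have := card_Einj_sum_le t1 t2 (h n); have := card_Einj_sum_le s1 s2 (g n).
rewrite [X in _ <= X]ger0_norm; last first.
  by rewrite !mulr_ge0 ?ler0n ?emb_density_ge0 ?invr_ge0 ?ler0n.
rewrite /emb_density card_sum card_ord exprD.
move: #|Einj (sum_perm s1 s2) _| #|Einj (sum_perm t1 t2) _| => I J.
move: #|Einj s1 _| #|Einj t1 _| #|Einj s2 _| #|Einj t2 _| #|Y| (fixed n) => I1 J1 I2 J2 y A lI lJ.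
have n0R : 0 < n%:R :> R by rewrite ltr0n.
have nk : 0 < n%:R ^+ k :> R by rewrite exprn_gt0.
have ny : 0 < n%:R ^+ y :> R by rewrite exprn_gt0.
rewrite -(ler_nat R) natrD !natrM natrX => defect.
have le : (I * J)%:R <= I1%:R * J1%:R * (I2%:R * J2%:R) :> R.
  by rewrite -!natrM ler_nat mulnACA leq_mul.
rewrite ler0_norm; last first.
  by rewrite subr_le0 mulrACA -invfM ler_pM2r ?invr_gt0 ?mulr_gt0 // -natrM.
have -> : - (I%:R * J%:R / (n%:R ^+ k * n%:R ^+ y) -
     I1%:R * J1%:R / n%:R ^+ k * (I2%:R * J2%:R / n%:R ^+ y)) =
   (n%:R * (I1%:R * J1%:R * (I2%:R * J2%:R)) - n%:R * (I%:R * J%:R)) /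
   (n%:R * (n%:R ^+ k * n%:R ^+ y)) :> R.
  by field; rewrite !gt_eqF.
rewrite ler_pdivrMr ?mulr_gt0 // lerBlDl; apply: le_trans defect _.
rewrite lerD2l [leRHS](_ : _ = 2 * k%:R * y%:R * (I2%:R * J2%:R) * (A%:R * n%:R ^+ k)) //.
by field; rewrite !gt_eqF.
Qed.

(** Transfers decorrelation from densities to means, since the factorial ratio is asymptotically
    multiplicative. *)
Lemma null_mean_decorrelation k (s1 t1 : {perm 'I_k}) (Y : finType) (s2 t2 : {perm Y}) :
  atom s1 t1 [set: 'I_k] -> tame s2 t2 ->
  null (fun n => mean (@emb _ (sum_perm s1 s2) (sum_perm t1 t2) n) -
                 mean (@emb _ s1 t1 n) * mean (@emb _ s2 t2 n)).
Proof.
move=> tr t2P; have t1P := tame_transitive tr.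
pose r m := ffact_ratio R m.
have rr : null (fun n => r (k + #|Y|)%N n - r k n * r #|Y| n).
  have r1 := @null_ffact_ratio R.
  apply: null_eq (nullD (r1 (k + #|Y|)%N) (nullN (nullD (nullM (@bdd_ffact_ratio R #|Y|) (r1 k)) (r1 #|Y|)))).
  by exists 0%N => n _; rewrite /r; ring.
apply: null_eq (nullD (nullM (@bdd_ffact_ratio R (k + #|Y|)%N) (null_decorrelation tr t2P))
  (nullM (bddM t1P t2P) rr)).
apply: ev_mono (ev_ge 1) => n n1.
by rewrite !mean_emb // card_sum !card_ord /r; ring.
Qed.

Lemma tame_sum k (s1 t1 : {perm 'I_k}) (Y : finType) (s2 t2 : {perm Y}) :
  atom s1 t1 [set: 'I_k] -> tame s2 t2 -> tame (sum_perm s1 s2) (sum_perm t1 t2).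
Proof.
move=> tr t2P; have t1P := tame_transitive tr.
apply: bdd_dom (bddD (null_bdd (null_decorrelation tr t2P)) (bddM t1P t2P)).
by exists 0%N => n _; rewrite subrK.
Qed.

Lemma emb_void n (p q : {perm 'I_n}) : emb (1%g : {perm void}) 1%g p q = 1.
Proof.
rewrite /emb; have -> : Einj (1%g : {perm void}) p :&: Einj 1%g q = [set: {ffun void -> 'I_n}].
  by apply/setP => f; rewrite finset.in_setI finset.in_setT; apply/andP; split; apply/EinjP; split; case.
by rewrite cardsT card_ffun card_void expn0.
Qed.

Lemma card_permE n : #|{perm 'I_n}|%:R = n`!%:R :> R.
Proof. by rewrite card_Sn. Qed.

Lemma mean_cst n (x : R) : mean (fun _ _ : {perm 'I_n} => x) = x.
Proof.
by rewrite /mean sumr_const -[_ *+ _]mulr_natl card_permE mulrC mulKf.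
Qed.

Lemma tame_void : tame (1%g : {perm void}) 1%g.
Proof.
apply: bdd_dom (bdd_cst 1); apply: ev_mono (ev_ge 1) => n n1.
have : mean (@emb _ (1%g : {perm void}) 1%g n) = 1.
  by rewrite -[RHS](mean_cst n); congr (_ / _); apply: eq_bigr => v _; rewrite emb_void.
have nf : n`!%:R != 0 :> R by rewrite pnatr_eq0 -lt0n fact_gt0.
by rewrite mean_emb // card_void /ffact_ratio expr0 mul1r subn0 divff // mulr1 => ->.
Qed.

Variable M : nat.

Definition small_atoms n (p q : {perm 'I_n}) := natoms p q (fun k => (k <= M)%N).

(** The mean of [small_atoms], decomposed by the transitive pair induced on the orbit. *)
Definition small_mean n : R :=
  \sum_(k < M.+1) \sum_(c : {perm 'I_k} * {perm 'I_k} | atom c.1 c.2 [set: 'I_k])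
    mean (@emb _ c.1 c.2 n) / (k`!)%:R.

Lemma bdd_small_mean : bdd small_mean.
Proof.
apply: bdd_sum => k _; apply: bdd_sum => c tr; apply: bddM; last exact: bdd_cst.
exact/tame_bdd_mean/tame_transitive.
Qed.

(** Induction on [m], peeling off one atom by [saturated_step]. The embedded pair and [r] are
    general because each step glues another transitive piece onto the pair. *)
Lemma null_emb_moment m r (Y : finType) (s t : {perm Y}) :
  saturated M r s t -> tame s t ->
  null (fun n => mean (fun p q : {perm 'I_n} => emb s t p q * ((small_atoms p q - r) ^_ m)%:R)
                 - mean (@emb _ s t n) * small_mean n ^+ m).
Proof.
elim: m r Y s t => [|m IH] r Y s t sat ts.
  apply: null_eq (@null0 R); exists 0%N => n _; rewrite expr0 mulr1; apply/eqP; rewrite subr_eq0; apply/eqP.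
  by congr (_ / _); apply: eq_bigr => v _; rewrite ffactn0 mulr1.
have step n (p q : {perm 'I_n}) : emb s t p q * ((small_atoms p q - r) ^_ m.+1)%:R =
    \sum_(k < M.+1) \sum_(c : {perm 'I_k} * {perm 'I_k} | atom c.1 c.2 [set: 'I_k])
      (emb (sum_perm c.1 s) (sum_perm c.2 t) p q * ((small_atoms p q - r.+1) ^_ m)%:R) / (k`!)%:R.
  rewrite ffactnS -subnS natrM mulrA /emb -natrM (saturated_step R p q sat) mulr_suml.
  apply: eq_bigr => k _; rewrite mulr_suml; apply: eq_bigr => c _.
  by rewrite mulrAC.
have meanE n : mean (fun p q : {perm 'I_n} => emb s t p q * ((small_atoms p q - r) ^_ m.+1)%:R) =
    \sum_(k < M.+1) \sum_(c : {perm 'I_k} * {perm 'I_k} | atom c.1 c.2 [set: 'I_k])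
      mean (fun p q : {perm 'I_n} => emb (sum_perm c.1 s) (sum_perm c.2 t) p q *
         ((small_atoms p q - r.+1) ^_ m)%:R) / (k`!)%:R.
  rewrite /mean (eq_bigr _ (fun v _ => step n (g n) (h n ^ v)%g)) exchange_big mulr_suml.
  apply: eq_bigr => k _; rewrite exchange_big mulr_suml; apply: eq_bigr => c _.
  by rewrite -mulr_suml mulrAC.
(* Induction hypothesis for each enlarged pair; there are finitely many, as [M] is fixed. *)
have part1 : null (fun n =>
    \sum_(k < M.+1) \sum_(c : {perm 'I_k} * {perm 'I_k} | atom c.1 c.2 [set: 'I_k])
    ((k`!)%:R^-1 * (mean (fun p q : {perm 'I_n} => emb (sum_perm c.1 s) (sum_perm c.2 t) p q *
         ((small_atoms p q - r.+1) ^_ m)%:R)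
      - mean (@emb _ (sum_perm c.1 s) (sum_perm c.2 t) n) * small_mean n ^+ m))).
  apply: null_sum => k _; apply: null_sum => c tr; apply: nullM (bdd_cst _) _.
  apply: IH; last exact: tame_sum.
  by apply: saturated_sum => //; rewrite card_ord -ltnS.
(* Splitting off the new piece by decorrelation; its means add up to one more factor
   [small_mean n]. *)
have part2 : null (fun n =>
    \sum_(k < M.+1) \sum_(c : {perm 'I_k} * {perm 'I_k} | atom c.1 c.2 [set: 'I_k])
    (((k`!)%:R^-1 * small_mean n ^+ m) * (mean (@emb _ (sum_perm c.1 s) (sum_perm c.2 t) n)
      - mean (@emb _ c.1 c.2 n) * mean (@emb _ s t n)))).
  apply: null_sum => k _; apply: null_sum => c tr; apply: nullM.
    by apply: bddM; [exact: bdd_cst | exact/bddX/bdd_small_mean].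
  exact: null_mean_decorrelation.
apply: null_eq (nullD part1 part2); exists 0%N => n _.
rewrite meanE exprS mulrCA {1}/small_mean mulr_suml -sumrB -big_split; apply: eq_bigr => k _.
rewrite mulr_suml -sumrB -big_split; apply: eq_bigr => c _ /=.
by ring.
Qed.

Lemma null_factorial_moment m :
  null (fun n => mean (fun p q : {perm 'I_n} => (small_atoms p q ^_ m)%:R) - small_mean n ^+ m).
Proof.
apply: null_eq (null_emb_moment m (saturated0 M) tame_void); exists 0%N => n _.
have -> : mean (@emb _ (1%g : {perm void}) 1%g n) = 1.
  by rewrite -[RHS](mean_cst n); congr (_ / _); apply: eq_bigr => v _; rewrite emb_void.
rewrite mul1r; congr (_ / _ - _); apply: eq_bigr => v _.
by rewrite emb_void mul1r subn0.
Qed.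
End Moments.

(** * Poisson limit *)

Section Bonferroni.
Local Open Scope ring_scope.
Variable R : realType.

Lemma alternating_binomial_sum (N r : nat) :
  \sum_(m < r.+1) (-1) ^+ m * 'C(N.+1, m)%:R = (-1) ^+ r * 'C(N, r)%:R :> R.
Proof.
elim: r => [|r IH]; first by rewrite big_ord_recr big_ord0 /= !bin0 expr0 add0r.
by rewrite big_ord_recr /= IH binS natrD exprS; ring.
Qed.

(** For positive [N] the truncated alternating sum is, up to sign, ['C(N.-1, r)]. *)
Lemma bonferroni (N r : nat) :
  `|(N == 0%N)%:R - \sum_(m < r.+1) (-1) ^+ m * 'C(N, m)%:R| <= 'C(N, r)%:R :> R.
Proof.
case: N => [|N].
  rewrite big_ord_recl /= bin0 expr0 mulr1 big1 => [|i _]; last by rewrite bin0n mulr0.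
  by rewrite addr0 subrr normr0.
rewrite sub0r normrN alternating_binomial_sum normrM normrX normrN1 expr1n mul1r.
by rewrite ger0_norm // ler_nat; case: r => [|r]; rewrite ?bin0 // binS leq_addr.
Qed.

Lemma expRN_lipschitz (x y : R) : 0 <= x -> 0 <= y ->
  `|expR (- x) - expR (- y)| <= `|x - y|.
Proof.
suff le (a b : R) : 0 <= a -> a <= b -> `|expR (- a) - expR (- b)| <= `|a - b|.
  move=> x0 y0; have [xy|/ltW yx] := leP x y; first exact: le.
  by rewrite distrC (distrC x); apply: le.
move=> a0 ab; have ea : expR (- a) <= 1 by rewrite -expR0 ler_expR oppr_le0.
rewrite ger0_norm ?subr_ge0 ?ler_expR ?lerN2 // ler0_norm ?subr_le0 // opprB.
have -> : expR (- b) = expR (- a) * expR (- (b - a)) by rewrite -expRD; congr expR; ring.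
rewrite -[X in X - _]mulr1 -mulrBr; apply: le_trans (_ : 1 - expR (- (b - a)) <= _).
  by rewrite ler_piMl // subr_ge0 -expR0 ler_expR oppr_le0 subr_ge0.
by have := expR_ge1Dx (- (b - a)); lra.
Qed.

Definition exp_partial (x : R) n : R := \sum_(m < n) x ^+ m / m`!%:R.

Lemma exp_partial_cvg (x e : R) : 0 < e ->
  ev (fun n => `|expR x - exp_partial x n| <= e).
Proof.
move=> e0; have cv : (series (exp_coeff x) @ \oo --> expR x)%classic.
  exact: is_cvg_series_exp_coeff.
have /cvgrPdist_le/(_ _ e0)[N _ HN] := cv.
by exists N => n /HN; rewrite /exp_partial /series /= big_mkord.
Qed.

Lemma exp_partial_le (x : R) n : 0 <= x -> exp_partial x n <= expR x.
Proof.
move=> x0; apply/ler_addgt0Pr => e e0; have [N HN] := exp_partial_cvg x e0.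
apply: le_trans (_ : exp_partial x (maxn n N) <= _); last first.
  by have := HN _ (leq_maxr n N); rewrite ler_distlC => /andP[]; lra.
rewrite /exp_partial -(subnKC (leq_maxl n N)) big_split_ord /= lerDl sumr_ge0 // => i _.
by rewrite divr_ge0 ?exprn_ge0 ?ler0n.
Qed.

(* Uniform in x on [0, B]: the tail of the series at -x is dominated by the tail at B. *)
Lemma exp_partial_uniform (B e : R) : 0 <= B -> 0 < e ->
  exists r, B ^+ r / r`!%:R <= e /\
    forall x, 0 <= x <= B -> `|expR (- x) - exp_partial (- x) r.+1| <= e.
Proof.
move=> B0 e0; have [r Hr] := exp_partial_cvg B e0.
have tail n : (r <= n)%N -> expR B - exp_partial B n <= e.
  by move=> /Hr; apply: le_trans; rewrite ler_norm.
exists r; split.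
  have := tail r (leqnn r); have := exp_partial_le r.+1 B0.
  by rewrite [exp_partial B r.+1]big_ord_recr /= -/(exp_partial B r); lra.
move=> x /andP[x0 xB]; apply/ler_addgt0Pr => d d0.
have [N HN] := exp_partial_cvg (- x) d0.
have rm : (r.+1 <= maxn r.+1 N)%N by exact: leq_maxl.
have {HN} := HN _ (leq_maxr r.+1 N); move: (maxn _ _) rm => m rm HN.
rewrite -(subrKA (exp_partial (- x) m)) addrC.
apply: le_trans (ler_normD _ _) (lerD _ HN).
have dom : `|exp_partial (- x) m - exp_partial (- x) r.+1| <=
    exp_partial B m - exp_partial B r.+1.
  rewrite /exp_partial -(subnKC rm) !big_split_ord /= addrAC subrr add0r addrAC subrr add0r.
  apply: le_trans (ler_norm_sum _ _ _) _; apply: ler_sum => i _.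
  rewrite normrM normrX normrN normfV (ger0_norm x0) (@ger0_norm _ _%:R) //.
  by rewrite ler_wpM2r ?invr_ge0 // lerXn2r ?nnegrE.
apply: le_trans dom _.
by have := tail r.+1 (leqnSn r); have := exp_partial_le m B0; lra.
Qed.
End Bonferroni.

Section Poisson.
Local Open Scope ring_scope.
Variable R : realType.
Variables (g h : forall n, {perm 'I_n}).

Local Notation mean n := (@mean R g h n).

Lemma mean_ge0 n F : (forall p q, 0 <= F p q) -> 0 <= mean n F.
Proof. by move=> F0; rewrite divr_ge0 ?ler0n // sumr_ge0. Qed.

Lemma mean_le n F G : (forall p q, F p q <= G p q) -> mean n F <= mean n G.
Proof. by move=> FG; rewrite ler_wpM2r ?invr_ge0 ?ler0n // ler_sum. Qed.

Lemma meanB n F G : mean n (fun p q => F p q - G p q) = mean n F - mean n G.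
Proof. by rewrite -mulrBl -sumrB. Qed.

Lemma norm_mean_le n F : `|mean n F| <= mean n (fun p q => `|F p q|).
Proof.
rewrite normrM normfV [`|n`!%:R|]ger0_norm ?ler0n // ler_wpM2r ?invr_ge0 ?ler0n //.
exact: ler_norm_sum.
Qed.

Lemma mean_sum n (I : finType) (F : I -> {perm 'I_n} -> {perm 'I_n} -> R) :
  mean n (fun p q => \sum_i F i p q) = \sum_i mean n (F i).
Proof. by rewrite -mulr_suml exchange_big. Qed.

Lemma meanZ n (x : R) F : mean n (fun p q => x * F p q) = x * mean n F.
Proof. by rewrite mulrA mulr_sumr. Qed.

(** Method of moments with a parameter that is only bounded and need not converge: the truncation
    [r] is chosen uniformly over the range of [mu], and only then is [n] taken large. *)
Lemma null_poisson (X : forall n, {perm 'I_n} -> {perm 'I_n} -> nat) (mu : nat -> R) :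
  (forall n, 0 <= mu n) -> bdd mu ->
  (forall m, null (fun n => mean n (fun p q => (X n p q ^_ m)%:R) - mu n ^+ m)) ->
  null (fun n => mean n (fun p q => (X n p q == 0%N)%:R) - expR (- mean n (fun p q => (X n p q)%:R))).
Proof.
move=> mu0 [C muC] mom e e0.
pose la n := mean n (fun p q => (X n p q)%:R).
have la0 n : 0 <= la n by apply: mean_ge0 => p q; exact: ler0n.
have la_mu : null (fun n => mu n - la n).
  apply: null_eq (nullN (mom 1)); exists 0%N => n _; rewrite expr1 opprB; congr (_ - _).
  by congr (_ / _); apply: eq_bigr => v _; rewrite ffactn1.
have e8 : 0 < e / 8 by rewrite divr_gt0.
have [r [r1 r2]] := exp_partial_uniform (normr_ge0 C) e8.
(* Truncated inclusion-exclusion, averaged and expressed through factorial moments. *)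
pose S n := \sum_(m < r.+1) ((-1) ^+ m / m`!%:R) * mean n (fun p q => (X n p q ^_ m)%:R).
have S_mu : null (fun n => S n - exp_partial (- mu n) r.+1).
  have S0 : null (fun n => \sum_(m < r.+1) ((-1) ^+ m / m`!%:R) *
      (mean n (fun p q => (X n p q ^_ m)%:R) - mu n ^+ m)).
    by apply: null_sum => m _; apply: nullM (bdd_cst _) (mom m).
  apply: null_eq S0; exists 0%N => n _.
  rewrite /S /exp_partial -sumrB; apply: eq_bigr => m _.
  by rewrite mulrBr [(- mu n) ^+ m]exprNn; congr (_ - _); rewrite mulrAC.
apply: ev_mono (ev_and muC (ev_and (la_mu _ e8) (ev_and (S_mu _ e8) (mom r _ e8)))).
move=> n [mC [h1 [h2 h3]]].
have muB : 0 <= mu n <= `|C|.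
  by rewrite mu0 /=; apply: le_trans (ler_norm _) (le_trans mC (ler_norm C)).
have h4 := r2 _ muB.
have h5 := le_trans (expRN_lipschitz (mu0 n) (la0 n)) h1.
have binE p q m : 'C(X n p q, m)%:R = (X n p q ^_ m)%:R / m`!%:R :> R.
  by rewrite -bin_ffact natrM mulfK // pnatr_eq0 -lt0n fact_gt0.
(* The Bonferroni error is the [r]-th factorial moment over [r!], close to [mu^r / r!], which is
   small by the choice of [r]. *)
have h6 : `|mean n (fun p q => (X n p q == 0%N)%:R) - S n| <= e / 4.
  have -> : mean n (fun p q => (X n p q == 0%N)%:R) - S n =
    mean n (fun p q => (X n p q == 0%N)%:R - \sum_(m < r.+1) (-1) ^+ m * 'C(X n p q, m)%:R).
    rewrite meanB mean_sum; congr (_ - _); apply: eq_bigr => m _.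
    rewrite -meanZ; congr (_ / _); apply: eq_bigr => v _.
    by rewrite binE mulrAC mulrA.
  apply: le_trans (norm_mean_le _) _.
  apply: le_trans (mean_le (fun p q => bonferroni _ _ r)) _.
  have -> : mean n (fun p q => 'C(X n p q, r)%:R) = mean n (fun p q => (X n p q ^_ r)%:R) / r`!%:R.
    by rewrite mulrC -meanZ; congr (_ / _); apply: eq_bigr => v _; rewrite binE mulrC.
  have rf : 1 <= r`!%:R :> R by rewrite ler1n fact_gt0.
  have rf0 : 0 < r`!%:R :> R by rewrite ltr0n fact_gt0.
  have : mu n ^+ r / r`!%:R <= `|C| ^+ r / r`!%:R.
    by rewrite ler_pM2r ?invr_gt0 // lerXn2r ?nnegrE //; case/andP: muB.
  have : (mean n (fun p q => (X n p q ^_ r)%:R) - mu n ^+ r) / r`!%:R <= e / 8.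
    rewrite ler_pdivrMr //; apply: le_trans (ler_norm _) (le_trans h3 _).
    by rewrite ler_peMr // ltW.
  by rewrite mulrBl; lra.
rewrite -/(la n).
have -> : mean n (fun p q => (X n p q == 0%N)%:R) - expR (- la n) =
   (mean n (fun p q => (X n p q == 0%N)%:R) - S n) + (S n - exp_partial (- mu n) r.+1) +
   (exp_partial (- mu n) r.+1 - expR (- mu n)) + (expR (- mu n) - expR (- la n)) by ring.
rewrite distrC in h4.
apply: le_trans (ler_normD _ _) _; apply: le_trans (lerD (ler_normD _ _) (lexx _)) _.
apply: le_trans (lerD (lerD (ler_normD _ _) (lexx _)) (lexx _)) _.
by lra.
Qed.
End Poisson.

(** * From class averages to small and large orbits *)

Section TransitiveProbability.
Local Open Scope ring_scope.
Variable R : realType.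
Variables (g h : forall n, {perm 'I_n}).
Local Notation mean n := (@mean R g h n).

Lemma Nsmall_natoms n (p q : {perm 'I_n}) :
  Nsmall p q = natoms p q (fun k => (k * 2 <= n)%N).
Proof.
by rewrite /Nsmall /natoms; apply: eq_card => A; rewrite !inE mem_orbits.
Qed.

Lemma NsmallJ n (p q u : {perm 'I_n}) : Nsmall (p ^ u)%g (q ^ u)%g = Nsmall p q.
Proof. by rewrite !Nsmall_natoms natoms_conj. Qed.

Lemma class_mean n (F : {perm 'I_n} -> {perm 'I_n} -> nat) :
  (forall p q u, F (p ^ u)%g (q ^ u)%g = F p q) ->
  (\sum_(p in conjclass (g n)) \sum_(q in conjclass (h n)) F p q)%:R /
    (#|conjclass (g n)| * #|conjclass (h n)|)%:R = mean n (fun p q => (F p q)%:R).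
Proof.
move=> FJ; have := sum_class_pair (g n) (h n) FJ.
rewrite -/(conjclass (g n)) -/(conjclass (h n)) cardsT card_Sn => E.
have c0 (u : {perm 'I_n}) : #|conjclass u|%:R != 0 :> R.
  by rewrite pnatr_eq0 -lt0n; apply/card_gt0P; exists u; rewrite /conjclass class_refl.
have nf : n`!%:R != 0 :> R by rewrite pnatr_eq0 -lt0n fact_gt0.
have cc0 : (#|conjclass (g n)| * #|conjclass (h n)|)%:R != 0 :> R by rewrite natrM mulf_neq0.
have -> : mean n (fun p q => (F p q)%:R) = (\sum_(v : {perm 'I_n}) F (g n) (h n ^ v)%g)%:R / n`!%:R.
  by rewrite natr_sum.
by apply/eqP; rewrite eqr_div // -!natrM mulnC E mulnC.
Qed.

Lemma probN0_mean n : probN0 R (g n) (h n) = mean n (fun p q => (Nsmall p q == 0%N)%:R).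
Proof.
rewrite -class_mean => [|p q u]; last by rewrite NsmallJ.
rewrite /probN0; congr (_%:R / _).
rewrite pair_big_dep /= -sum1_card [LHS]big_mkcond [RHS]big_mkcond; apply: eq_bigr => -[p q] _ /=.
by rewrite inE /=; case: (p \in _); case: (q \in _); case: eqP.
Qed.

Lemma expN_mean n : expN R (g n) (h n) = mean n (fun p q => (Nsmall p q)%:R).
Proof. by rewrite -class_mean // => p q u; rewrite NsmallJ. Qed.

Definition large_atoms M n (p q : {perm 'I_n}) :=
  natoms p q (fun k => (M < k)%N && (k * 2 <= n)%N).

Lemma Nsmall_split M n (p q : {perm 'I_n}) : (M * 2 <= n)%N ->
  Nsmall p q = (small_atoms M p q + large_atoms M p q)%N.
Proof.
move=> Mn; rewrite Nsmall_natoms /natoms -(cardsID [set A : {set 'I_n} | (#|A| <= M)%N]).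
congr (_ + _)%N; apply: eq_card => A; rewrite !inE; last by rewrite -ltnNge andbCA.
rewrite -andbA; congr (_ && _).
by rewrite andb_idl // => AM; apply: leq_trans Mn; rewrite leq_mul2r AM.
Qed.

(** Atoms are sorted by size; the factor [k! (n - k)! / n!] from [sum_natoms_le] is the inverse
    binomial. *)
Lemma mean_large_atoms M n : mean n (fun p q => (large_atoms M p q)%:R) <=
  \sum_(k < n.+1 | (M < k)%N && (k * 2 <= n)%N) inv_set_mean R (g n) (h n) k.
Proof.
have E p q : (large_atoms M p q)%:R =
    \sum_(k < n.+1) if (M < k)%N && (k * 2 <= n)%N then (@natoms 'I_n p q (pred1 (k : nat)))%:R else 0 :> R.
  rewrite -big_mkcond -natr_sum /large_atoms /natoms; congr _%:R.
  rewrite -sum1_card (partition_big (fun A : {set 'I_n} => inord #|A| : 'I_n.+1)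
     (fun k : 'I_n.+1 => (M < k)%N && (k * 2 <= n)%N)) /=.
    apply: eq_bigr => k kP; rewrite -sum1_card; apply: eq_bigl => A; rewrite !inE.
    have lA : (#|A| < n.+1)%N by rewrite ltnS -[X in (_ <= X)%N]card_ord max_card.
    rewrite -val_eqE /= inordK //; case: eqP => [->|_]; last by rewrite !andbF.
    by rewrite kP !andbT.
  move=> A; rewrite inE => /andP[_ AP].
  by rewrite inordK // ltnS -[X in (_ <= X)%N]card_ord max_card.
have -> : mean n (fun p q => (large_atoms M p q)%:R) =
    \sum_(k < n.+1) mean n (fun p q => if (M < k)%N && (k * 2 <= n)%N then (natoms p q (pred1 (k : nat)))%:R else 0).
  by rewrite -mean_sum; congr (_ / _); apply: eq_bigr => v _; rewrite E.
rewrite [leRHS]big_mkcond; apply: ler_sum => k _; case: ifP => [/andP[_ kn]|_]; last by rewrite mean_cst.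
have kn' : (k <= n)%N by apply: leq_trans kn; rewrite leq_pmulr.
have kf : k`!%:R != 0 :> R by rewrite pnatr_eq0 -lt0n fact_gt0.
have nkf : (n - k)`!%:R != 0 :> R by rewrite pnatr_eq0 -lt0n fact_gt0.
have bn : 'C(n, k)%:R != 0 :> R by rewrite pnatr_eq0 -lt0n bin_gt0.
have nf : 0 < n`!%:R :> R by rewrite ltr0n fact_gt0.
apply: le_trans (_ : (#|inv_sets (g n) k| * #|inv_sets (h n) k| * (k`! * (n - k)`!))%:R / n`!%:R <= _).
  rewrite ler_pM2r ?invr_gt0 // -natr_sum ler_nat.
  by apply: leq_trans (sum_natoms_le (g n) (h n) k) _; rewrite card_ord.
rewrite /inv_set_mean -(bin_fact kn') !natrM.
by rewrite le_eqVlt; apply/orP; left; apply/eqP; field; rewrite kf nkf bn.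
Qed.
End TransitiveProbability.

(** * Combining the Poisson limit with the tail bound *)

Section Assembly.
Local Open Scope ring_scope.
Variable R : realType.
Variables (g h : forall n, {perm 'I_n}) (K eps : R).
Hypothesis eps01 : 0 < eps <= 1.
Hypothesis K0 : 0 <= K.
Hypothesis fixed_small : forall d : R, 0 < d ->
  ev (fun n => (ncycles (g n) 1 + ncycles (h n) 1)%:R ^+ 3 <= d * n%:R ^+ 2).
Hypothesis products_bounded : ev (fun n =>
  [/\ (ncycles (g n) 1)%:R * (ncycles (h n) 1)%:R <= K * n%:R,
      (ncycles (g n) 1)%:R ^+ 2 * (ncycles (h n) 2)%:R <= K * n%:R ^+ 2 &
      (ncycles (h n) 1)%:R ^+ 2 * (ncycles (g n) 2)%:R <= K * n%:R ^+ 2]).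
Hypothesis transpositions_bounded : forall n,
  (ncycles (g n) 2)%:R + (ncycles (h n) 2)%:R <= (1 - eps) * n%:R.

(** [M] is fixed first so that the expected number [T] of large orbits is at most [e / 3]; ignoring
    them changes the probability and the exponential by at most [T] each. *)
Lemma null_probN0_expN : null (fun n => probN0 R (g n) (h n) - expR (- expN R (g n) (h n))).
Proof.
move=> e e0; have e3 : 0 < e / 3 by rewrite divr_gt0.
have [M HM] := inv_set_mean_tail eps01 K0 fixed_small products_bounded transpositions_bounded e3.
have mu0 n : 0 <= small_mean R g h M n.
  by apply: sumr_ge0 => k _; apply: sumr_ge0 => c _; rewrite divr_ge0 ?ler0n // mean_ge0.
have pois := null_poisson mu0 (bdd_small_mean K0 fixed_small products_bounded M)
  (null_factorial_moment K0 fixed_small products_bounded M).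
apply: ev_mono (ev_and HM (ev_and (pois _ e3) (ev_ge (M * 2)))) => n [tail [main Mn]].
rewrite probN0_mean expN_mean.
set T := mean g h (fun p q : {perm 'I_n} => (large_atoms M p q)%:R : R).
have T_le : T <= e / 3 := le_trans (mean_large_atoms R g h M n) tail.
set P := mean g h (fun p q : {perm 'I_n} => (Nsmall p q == 0%N)%:R : R).
set E := mean g h (fun p q : {perm 'I_n} => (Nsmall p q)%:R : R).
set P' := mean g h (fun p q : {perm 'I_n} => (small_atoms M p q == 0%N)%:R) in main.
set E' := mean g h (fun p q : {perm 'I_n} => (small_atoms M p q)%:R) in main.
have E'0 : 0 <= E' by apply: mean_ge0 => p q; exact: ler0n.
have T0 : 0 <= T by apply: mean_ge0 => p q; exact: ler0n.
have EE : E = E' + T.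
  rewrite /E /E' /T -mulrDl -big_split; congr (_ / _); apply: eq_bigr => v _.
  by rewrite (Nsmall_split _ _ Mn) natrD.
(* Markov's inequality: the two events differ only when some large orbit exists. *)
have dP : `|P - P'| <= T.
  rewrite -meanB; apply: le_trans (norm_mean_le _ _ _) _; apply: mean_le => p q.
  rewrite (Nsmall_split _ _ Mn) addn_eq0; case: (small_atoms M p q == 0%N) => /=; last by rewrite subr0 normr0.
  by case: (large_atoms M p q) => [|m] /=; rewrite ?subrr ?normr0 // sub0r normrN normr1 ler1n.
have dE : `|expR (- E') - expR (- E)| <= T.
  apply: le_trans (expRN_lipschitz E'0 _) _; first by rewrite EE addr_ge0.
  by rewrite EE opprD addrA subrr sub0r normrN ger0_norm.
have -> : P - expR (- E) = (P - P') + (P' - expR (- E')) + (expR (- E') - expR (- E)) by ring.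
apply: le_trans (ler_normD _ _) _; apply: le_trans (lerD (ler_normD _ _) (lexx _)) _.
by move: main dP dE T_le; lra.
Qed.
End Assembly.

Local Open Scope classical_set_scope.
Local Open Scope ring_scope.

Theorem theorem3p10 (R : realType) (g h : forall n : nat, {perm 'I_n}) :
  (fun n : nat => ((ncycles (g n) 1 + ncycles (h n) 1)%N%:R : R)
                   / (n%:R `^ (2 / 3))) @ \oo --> (0 : R) ->
  (exists K : R, \forall n \near \oo,
      ((ncycles (g n) 1)%:R + Num.sqrt (ncycles (g n) 2)%:R)
      * ((ncycles (h n) 1)%:R + Num.sqrt (ncycles (h n) 2)%:R) <= K * n%:R) ->
  (exists eps : R, 0 < eps /\ forall n : nat,
      ((ncycles (g n) 2 + ncycles (h n) 2)%N%:R : R) <= (1 - eps) * n%:R) ->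
  (fun n : nat => probN0 R (g n) (h n) - expR (- expN R (g n) (h n))) @ \oo --> (0 : R).
Proof.
move=> fixed0 [K [N0 _ KP]] [eps [eps0 epsP]].
have fixed_small (d : R) : 0 < d ->
    ev (fun n => (ncycles (g n) 1 + ncycles (h n) 1)%:R ^+ 3 <= d * n%:R ^+ 2).
  (* The bound is cubed below, and the cube of a number at most 1 does not exceed it. *)
  move=> d0; have d1 : 0 < Num.min 1 d by rewrite lt_min ltr01.
  have /cvgr0Pnorm_le/(_ _ d1)[N _ HN] := fixed0.
  apply: ev_mono (ev_and (ev_ge 1) (ex_intro _ N HN)) => n [n1 /=].
  have n0 : 0 < n%:R :> R by rewrite ltr0n.
  have p0 : 0 < n%:R `^ (2 / 3) :> R by rewrite powR_gt0.
  have p3 : (n%:R `^ (2 / 3)) ^+ 3 = n%:R ^+ 2 :> R.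
    rewrite -powR_mulrn ?powR_ge0 // -powRrM -powR_mulrn ?ler0n //.
    by congr (_ `^ _); field.
  rewrite ger0_norm ?divr_ge0 ?ler0n ?powR_ge0 // ler_pdivrMr // => le.
  have := lerXn2r 3 (ler0n R _) (le_trans (ler0n R _) le) le.
  rewrite exprMn p3 => {}le; apply: le_trans le _.
  rewrite ler_wpM2r ?exprn_ge0 ?ler0n //.
  apply: le_trans (_ : Num.min 1 d <= _); last by rewrite ge_min lexx orbT.
  have m1 : Num.min 1 d <= 1 by rewrite ge_min lexx.
  have := ler_wiXn2l (ltW d1) m1 (isT : (1 <= 3)%N).
  by rewrite expr1.
(* One constant for the product bound and for the squared ones; the absolute value allows a negative
   [K]. *)
pose K1 := `|K| + `|K| ^+ 2.
have K10 : 0 <= K1 by rewrite addr_ge0 ?exprn_ge0.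
have products : ev (fun n =>
  [/\ (ncycles (g n) 1)%:R * (ncycles (h n) 1)%:R <= K1 * n%:R,
      (ncycles (g n) 1)%:R ^+ 2 * (ncycles (h n) 2)%:R <= K1 * n%:R ^+ 2 &
      (ncycles (h n) 1)%:R ^+ 2 * (ncycles (g n) 2)%:R <= K1 * n%:R ^+ 2]).
  apply: ev_mono (ex_intro _ N0 KP) => n /= le.
  move: (ncycles (g n) 1) (ncycles (h n) 1) (ncycles (g n) 2) (ncycles (h n) 2) le => a a' b b' le.
  have s0 (m : nat) : 0 <= Num.sqrt m%:R :> R by exact: sqrtr_ge0.
  have {}le : (a%:R + Num.sqrt b%:R) * (a'%:R + Num.sqrt b'%:R) <= `|K| * n%:R.
    by apply: le_trans le _; rewrite ler_wpM2r ?ler0n // ler_norm.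
  (* Each mixed term of the expanded product is bounded separately, then squared to remove the
     root. *)
  have sq (c d : nat) : c%:R * Num.sqrt d%:R <= `|K| * n%:R :> R -> c%:R ^+ 2 * d%:R <= K1 * n%:R ^+ 2 :> R.
    move=> cd; rewrite -[d%:R in leLHS]sqr_sqrtr ?ler0n // -exprMn.
    apply: le_trans (_ : (`|K| * n%:R) ^+ 2 <= _).
      by rewrite lerXn2r ?nnegrE ?mulr_ge0 ?ler0n.
    by rewrite exprMn ler_wpM2r ?exprn_ge0 ?ler0n // lerDr.
  have ge0 (x y : R) : 0 <= x -> 0 <= y -> 0 <= x * y by exact: mulr_ge0.
  have h1 := ge0 _ _ (ler0n R a) (s0 b'); have h2 := ge0 _ _ (s0 b) (ler0n R a').
  have h3 := ge0 _ _ (s0 b) (s0 b'); have h4 := ge0 _ _ (ler0n R a) (ler0n R a').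
  rewrite mulrDl !mulrDr in le.
  split; [|by apply: sq; lra|by apply: sq; rewrite mulrC; lra].
  have : 0 <= `|K| ^+ 2 * n%:R by rewrite mulr_ge0 ?exprn_ge0 ?ler0n.
  by rewrite /K1 mulrDl; lra.
(* The tail estimates assume [eps <= 1], and shrinking [eps] only weakens the hypothesis on
   transpositions. *)
have e1 : 0 < Num.min 1 eps <= 1 by rewrite lt_min ltr01 eps0 ge_min lexx.
have transp n : (ncycles (g n) 2)%:R + (ncycles (h n) 2)%:R <= (1 - Num.min 1 eps) * n%:R.
  rewrite -natrD; apply: le_trans (epsP n) _; rewrite ler_wpM2r ?ler0n // lerB //.
  by rewrite ge_min lexx orbT.
apply/cvgr0Pnorm_le => e e0.
have [N HN] := null_probN0_expN e1 K10 fixed_small products transp e0.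
by exists N.
Qed.
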